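(* Let $E$ be a Banach space and $\mathcal D$ an AM-convexity condition. Then $\mathrm{FBL}^{\mathcal D}[E]$ is isometrically lattice isomorphic to the $\|\cdot\|_\infty$-closed sublattice of $C(B_{E^*})$ generated by $\{\delta_x : x\in E\}$.
   Context: All vector spaces, Banach spaces and Banach lattices are real; ''operator'' means bounded linear operator, ''lattice homomorphism'' means linear lattice homomorphism, and a sublattice is a linear subspace closed under finite suprema and infima. For $m\in\mathbb N$, $\mathcal H_m$ denotes the vector lattice of continuous, positively homogeneous functions $\mathbb R^m\to\mathbb R$. For a Banach lattice $X$, $h\in\mathcal H_m$ and $x_1,\dots,x_m\in X$, the element $h(x_1,\dots,x_m)\in X$ is defined by the positively homogeneous continuous function calculus: it is $\Phi(h)$, where $\Phi\colon\mathcal H_m\to X$ is the unique lattice homomorphism sending the $k$-th coordinate projection to $x_k$ for each $k$. A function $h\in\mathcal H_m$ is monotone on $\mathbb R^m_+$ if $h(t_1,\dots,t_m)\le h(s_1,\dots,s_m)$ whenever $0\le t_k\le s_k$ for all $k$; $\mathcal H_m^{>0}$ is the set of $h\in\mathcal H_m$ that are monotone on $\mathbb R^m_+$. A convexity condition is a triple $\mathcal D=(\mathcal G,M,\vartheta)$, where $\mathcal G$ is a nonempty subset of $\bigcup_{m=1}^\infty\mathcal H_m^{>0}$ and $M\colon\mathcal G\to[1,\infty)$ and $\vartheta\colon\mathcal G\to\{0,1\}$ are arbitrary functions. A Banach lattice $X$ is $\mathcal D$-convex if, for every $m\in\mathbb N$ and $g\in\mathcal G\cap\mathcal H_m^{>0}$,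 the inequality $\|g(x_1,\dots,x_m)\|\le M(g)\cdot g(\|x_1\|,\dots,\|x_m\|)$ holds for all pairwise disjoint $x_1,\dots,x_m\in X_+$ if $\vartheta(g)=0$, and for all $x_1,\dots,x_m\in X_+$ if $\vartheta(g)=1$. An AM-convexity condition is a convexity condition $\mathcal D=(\mathcal G,M,\vartheta)$ such that the function $\|\cdot\|_{\ell_\infty^2}\colon(s,t)\mapsto|s|\vee|t|$ belongs to $\mathcal G$ and $M(\|\cdot\|_{\ell_\infty^2})=1$. For a Banach space $E$, the free $\mathcal D$-convex Banach lattice over $E$ is the pair $(\mathrm{FBL}^{\mathcal D}[E],\phi_E^{\mathcal D})$ (it exists and is unique up to isometric lattice isomorphism compatible with the embeddings of $E$) consisting of a $\mathcal D$-convex Banach lattice $\mathrm{FBL}^{\mathcal D}[E]$ and a linear isometry $\phi_E^{\mathcal D}\colon E\to\mathrm{FBL}^{\mathcal D}[E]$ such that for every $\mathcal D$-convex Banach lattice $X$ and every operator $T\colon E\to X$ there is a unique lattice homomorphism $\widehat T\colon\mathrm{FBL}^{\mathcal D}[E]\to X$ with $\widehat T\circ\phi_E^{\mathcal D}=T$, and moreover $\|\widehat T\|=\|T\|$. $B_{E^*}$ is the closed unit ball of the dual $E^*$, equipped with the relative weak$^*$ topology, and $\delta_x\in C(B_{E^*})$ is given by $\delta_x(x^* )=x^*(x)$ for $x\in E$, $x^*\in B_{E^*}$. *)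

(* Defs.v *)
From HB Require Import structures.
From mathcomp Require Import all_boot all_order all_algebra.
From mathcomp Require Import all_classical all_reals all_analysis.
Set Implicit Arguments.
Unset Strict Implicit.
Unset Printing Implicit Defensive.
Import Order.TTheory GRing.Theory Num.Theory.
Import numFieldNormedType.Exports.
Local Open Scope classical_set_scope.
Local Open Scope ring_scope.

(* The order is bundled here rather than inherited from [Order.Lattice]: MathComp
   forces the display of any order on a zmodType to be [ring_display] and its
   numeric hierarchy provides no join of lattices with normed modules, so that
   Hierarchy Builder rejects a structure inheriting from both. *)
HB.mixin Record Lmodule_isVectorLattice (R : realType) X of GRing.Lmodule R X := {
  vle : X -> X -> Prop ;
  vsup : X -> X -> X ;
  vinf : X -> X -> X ;
  vle_refl : forall x, vle x x ;
  vle_anti : forall x y, vle x y -> vle y x -> x = y ;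
  vle_trans : forall y x z, vle x y -> vle y z -> vle x z ;
  vsup_le : forall x y z, vle (vsup x y) z <-> vle x z /\ vle y z ;
  vinf_ge : forall x y z, vle z (vinf x y) <-> vle z x /\ vle z y ;
  vle_addr : forall z x y, vle x y -> vle (x + z) (y + z) ;
  vle_scale : forall (a : R) x, 0 <= a -> vle 0 x -> vle 0 (a *: x)
}.

#[short(type="vectorLatticeType")]
HB.structure Definition VectorLattice (R : realType) :=
  {X of Lmodule_isVectorLattice R X & GRing.Lmodule R X}.

Definition vabs (R : realType) (X : vectorLatticeType R) (x : X) : X :=
  vsup x (- x).

HB.mixin Record VectorLattice_isBanachLattice (R : realType) X
    of VectorLattice R X & CompleteNormedModule R X := {
  vabs_norm_le : forall x y : X, vle (vabs x) (vabs y) -> `|x| <= `|y|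
}.

#[short(type="banachLatticeType")]
HB.structure Definition BanachLattice (R : realType) :=
  {X of VectorLattice_isBanachLattice R X & VectorLattice R X
      & CompleteNormedModule R X}.

Section FunVectorLattice.
Variables (R : realType) (T : Type).
Implicit Types f g h : T -> R.

Let fle f g : Prop := forall t, f t <= g t.
Let fsup f g : T -> R := fun t => Num.max (f t) (g t).
Let finf f g : T -> R := fun t => Num.min (f t) (g t).

Let fle_refl f : fle f f. Proof. by move=> t. Qed.

Let fle_anti f g : fle f g -> fle g f -> f = g.
Proof. by move=> fg gf; apply/funext => t; apply/le_anti; rewrite fg gf. Qed.

Let fle_trans g f h : fle f g -> fle g h -> fle f h.
Proof. by move=> fg gh t; exact: le_trans (fg t) (gh t). Qed.

Let fsup_le f g h : fle (fsup f g) h <-> fle f h /\ fle g h.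
Proof.
split=> [fgh|[fh gh] t]; last by rewrite /fsup ge_max fh gh.
by split=> t; have := fgh t; rewrite /fsup ge_max => /andP[].
Qed.

Let finf_ge f g h : fle h (finf f g) <-> fle h f /\ fle h g.
Proof.
split=> [fgh|[fh gh] t]; last by rewrite /finf le_min fh gh.
by split=> t; have := fgh t; rewrite /finf le_min => /andP[].
Qed.

Let fle_addr h f g : fle f g -> fle (f + h) (g + h).
Proof. by move=> fg t; rewrite lerD2r; exact: fg. Qed.

Let fle_scale (a : R) f : 0 <= a -> fle 0 f -> fle 0 (a *: f).
Proof. by move=> a0 f0 t; apply: mulr_ge0 => //; exact: f0. Qed.

(* [T -> R] with pointwise order and operations. *)
HB.instance Definition _ := Lmodule_isVectorLattice.Build R (T -> R)
  fle_refl fle_anti fle_trans fsup_le finf_ge fle_addr fle_scale.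

End FunVectorLattice.

Section LatticeHom.
Variables (R : realType) (U V : vectorLatticeType R).

Definition sublattice (A : set U) : Prop :=
  [/\ A 0,
      forall (a : R) u v, A u -> A v -> A (a *: u + v),
      forall u v, A u -> A v -> A (vsup u v)
    & forall u v, A u -> A v -> A (vinf u v)].

(* Linear lattice homomorphism with domain the sublattice [A]; the values of
   [f] outside [A] are irrelevant. *)
Definition lattice_hom_on (A : set U) (f : U -> V) : Prop :=
  [/\ forall (a : R) u v, A u -> A v -> f (a *: u + v) = a *: f u + f v,
      forall u v, A u -> A v -> f (vsup u v) = vsup (f u) (f v)
    & forall u v, A u -> A v -> f (vinf u v) = vinf (f u) (f v)].

Definition lattice_hom (f : U -> V) : Prop := lattice_hom_on [set: U] f.

End LatticeHom.

Definition disjoint_vl (R : realType) (X : vectorLatticeType R) (x y : X) :=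
  vinf (vabs x) (vabs y) = 0.

(* Only meaningful when the supremum is finite, i.e. for bounded [T]. *)
Definition opnorm (R : realType) (V W : normedModType R) (T : V -> W) : R :=
  sup [set `|T x| | x in [set x | `|x| <= 1]].

Section FunctionCalculus.
Variable R : realType.

(* The vector lattice H_m, as a sublattice of the functions R^m -> R. *)
Definition Hm (m : nat) : set ('rV[R]_m -> R) :=
  [set h | continuous h /\
           forall (a : R) (t : 'rV[R]_m), 0 <= a -> h (a *: t) = a * h t].

Definition monotone_pos (m : nat) (h : 'rV[R]_m -> R) : Prop :=
  forall t s : 'rV[R]_m,
    (forall k, 0 <= t ord0 k <= s ord0 k) -> h t <= h s.

Definition coordf (m : nat) (k : 'I_m) : 'rV[R]_m -> R := fun t => t ord0 k.

(* [fcalc x h] is h(x_1, ..., x_m): [fcalc x] is the lattice homomorphism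
   H_m -> X sending the k-th coordinate to [x k], which exists and is unique
   on H_m in every Banach lattice; its values outside H_m are irrelevant. *)
Definition fcalc (X : banachLatticeType R) (m : nat) (x : 'I_m -> X) :
    ('rV[R]_m -> R) -> X :=
  get [set Phi : ('rV[R]_m -> R) -> X |
       lattice_hom_on (@Hm m) Phi /\ forall k, Phi (coordf k) = x k].

End FunctionCalculus.

(* A triple (G, M, theta): [cc_fun m] is the m-variable part of G,
   [cc_all m g] stands for theta(g) = 1, and the values of [cc_const] and
   [cc_all] outside G are irrelevant. *)
Record convexity_condition (R : realType) := ConvexityCondition {
  cc_fun : forall m, set ('rV[R]_m -> R) ;
  cc_const : forall m, ('rV[R]_m -> R) -> R ;
  cc_all : forall m, ('rV[R]_m -> R) -> bool ;
  cc_nonempty : exists m g, @cc_fun m g ;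
  cc_fun_sub : forall m g, @cc_fun m g ->
    [/\ (0 < m)%N, Hm g & monotone_pos g] ;
  cc_const_ge1 : forall m g, @cc_fun m g -> 1 <= @cc_const m g
}.

Definition Dconvex (R : realType) (D : convexity_condition R)
    (X : banachLatticeType R) : Prop :=
  forall (m : nat) (g : 'rV[R]_m -> R), cc_fun D g ->
  forall x : 'I_m -> X,
    (forall k, vle 0 (x k)) ->
    (cc_all D g = false -> forall j k, j != k -> disjoint_vl (x j) (x k)) ->
    `|fcalc x g| <= cc_const D g * g (\row_k `|x k|).

Definition linf2 (R : realType) : 'rV[R]_2 -> R :=
  fun t => Num.max `|t ord0 ord0| `|t ord0 ord_max|.

Definition AM_convexity (R : realType) (D : convexity_condition R) : Prop :=
  cc_fun D (@linf2 R) /\ cc_const D (@linf2 R) = 1.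

(* [(F, phi)] is the free D-convex Banach lattice over [E]. *)
Definition free_Dconvex (R : realType) (D : convexity_condition R)
    (E : completeNormedModType R) (F : banachLatticeType R)
    (phi : E -> F) : Prop :=
  [/\ Dconvex D F,
      linear phi,
      forall x, `|phi x| = `|x|
    & forall (X : banachLatticeType R) (T : E -> X),
        Dconvex D X -> linear T -> continuous T ->
        exists That : F -> X,
          [/\ lattice_hom That, That \o phi = T,
              forall S : F -> X, lattice_hom S -> S \o phi = T -> S = That
            & opnorm That = opnorm T]].

Section DualBall.
Variables (R : realType) (E : completeNormedModType R).

(* As a subset of [{ptws E -> R}], its relative topology is the weak* one. *)
Definition dual_ball : set {ptws E -> R} :=
  [set f | [/\ linear (f : E -> R), continuous (f : E -> R)
             & opnorm (f : E -> R) <= 1]].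

Definition delta (x : E) : set_type dual_ball -> R :=
  fun f => (set_val f : E -> R) x.

End DualBall.

Arguments dual_ball {R} E _.

Section ContinuousFunctions.
Variables (R : realType) (K : topologicalType).

Definition Cfun : set (K -> R) := [set f | continuous f].

(* Only meaningful for bounded [f], in particular for [f] in C(K), K compact. *)
Definition sup_norm (f : K -> R) : R := sup (range (fun k => `|f k|)).

(* Closed subsets of [Cfun] for the sup norm are closed for uniform
   convergence among all functions [K -> R], since [Cfun] itself is. *)
Definition closed_sublattice (A : set (K -> R)) : Prop :=
  [/\ A `<=` Cfun, sublattice A & closed (A : set {uniform K -> R})].

Definition closed_sublattice_gen (S : set (K -> R)) : set (K -> R) :=
  smallest closed_sublattice S.

End ContinuousFunctions.

(* Main.v *)
Require Import Defs.
From HB Require Import structures.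
From mathcomp Require Import all_boot all_order all_algebra.
From mathcomp Require Import all_classical all_reals all_analysis.
From mathcomp Require Import ring lra.
Set Implicit Arguments.
Unset Strict Implicit.
Unset Printing Implicit Defensive.
Import Order.TTheory GRing.Theory Num.Theory.
Import numFieldNormedType.Exports.
Local Open Scope classical_set_scope.
Local Open Scope ring_scope.

(** The representation sends [u] in [F] to the function [b |-> b^ u] on the dual
    ball, where [b^ : F -> R] is the unique lattice homomorphism with
    [b^ o phi = b] ([free_hom_extend], [free_hom_unique]). The universal property
    is applied to the real line only, which is D-convex since the elements of
    [Hm] act on it by evaluation ([fcalc_real], [Dconvex_real]). The map is a
    lattice homomorphism, it sends [phi x] to [delta x], and it is contractive;
    what has to be proved is that it preserves the norm and that it has the right
    range.

    Isometry. The function calculus of [F] turns the function [(s, t) |->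
    max(|s|, |t|)] into [|x| \/ |y|] ([fcalc_linf2]), so that the AM condition
    bounds [|x \/ y|] by [max(|x|, |y|)] for disjoint positive [x] and [y], hence
    for all positive ones ([norm_vsup_max]). Then [x |-> |x^+|] is sublinear and
    sends binary suprema to maxima. A minimal functional of this kind is linear,
    hence a lattice homomorphism, and Zorn's lemma gives one below [|x^+|] that
    attains a prescribed value ([max_gauge_lattice_hom], [norming_hom]). This is
    Kakutani's representation theorem for AM-spaces: the norm of [u] is the
    maximum of [|tau u|] over the real lattice homomorphisms [tau] of norm at most
    one, and each of these is [b^] for [b = tau o phi] in the dual ball.

    Range. Those [tau] form a compact space for pointwise convergence
    ([compact_hom_ball]). If [A] is a closed sublattice of functions containing
    the [delta x], the elements of [F] represented in [A] form a sublattice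
    containing the generators. Two homomorphisms that are proportional on it are
    proportional everywhere, by uniqueness, so the lattice form of the
    Stone-Weierstrass theorem ([lattice_stone_weierstrass],
    [sublattice_two_points]) shows that it is dense; so all of [F] is represented
    in [A]. Conversely the range is itself a closed sublattice, because an
    isometric image of a complete space is closed.

    Minimal gauges also supply the vector lattice theory that this needs. On the
    ideal generated by [e >= 0] they yield enough real lattice homomorphisms to
    determine the order ([ideal_hom_vle]), so that lattice-linear inequalities
    between real numbers hold in every Banach lattice ([leval_vle]), and so that
    the function calculus can be built by prescribing the values
    [tau (h(x_1, ..., x_m)) = h(tau x_1, ..., tau x_m)]
    ([fcalc_hom]), starting from the coordinates and passing to uniform limits
    ([Hm_dense], [ideal_complete]). *)

(** * The real line as a Banach lattice; order and norm in Banach lattices *)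

Section RealBanachLattice.
Variable R : realType.
Implicit Types x y z : R^o.

Let rle x y : Prop := x <= y.
Let rsup x y : R^o := Num.max (x : R) y.
Let rinf x y : R^o := Num.min (x : R) y.

Let rle_refl x : rle x x. Proof. exact: lexx. Qed.

Let rle_anti x y : rle x y -> rle y x -> x = y.
Proof. by move=> xy yx; apply/le_anti; rewrite xy yx. Qed.

Let rle_trans y x z : rle x y -> rle y z -> rle x z.
Proof. exact: le_trans. Qed.

Let rsup_le x y z : rle (rsup x y) z <-> rle x z /\ rle y z.
Proof. by rewrite /rle ge_max; split=> [/andP[]|[-> ->]]. Qed.

Let rinf_ge x y z : rle z (rinf x y) <-> rle z x /\ rle z y.
Proof. by rewrite /rle le_min; split=> [/andP[]|[-> ->]]. Qed.

Let rle_addr z x y : rle x y -> rle (x + z) (y + z).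
Proof. by rewrite /rle lerD2r. Qed.

Let rle_scale (a : R) x : 0 <= a -> rle 0 x -> rle 0 (a *: x).
Proof. exact: mulr_ge0. Qed.

HB.instance Definition _ := Lmodule_isVectorLattice.Build R R^o
  rle_refl rle_anti rle_trans rsup_le rinf_ge rle_addr rle_scale.

Let rabs_norm_le x y : vle (vabs x) (vabs y) -> `|x| <= `|y|.
Proof.
have E (t : R) : `|t| = Num.max t (- t).
  by case: (ger0P t) => ?; [rewrite max_l|rewrite max_r]; lra.
by move=> H; rewrite [`|x|]E [`|y|]E.
Qed.

HB.instance Definition _ :=
  VectorLattice_isBanachLattice.Build R R^o rabs_norm_le.

End RealBanachLattice.

Section VectorLatticeBasics.
Variables (R : realType) (X : vectorLatticeType R).
Implicit Types (x y z : X) (a : R).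

Lemma vleD x y z t : vle x y -> vle z t -> vle (x + z) (y + t).
Proof.
move=> xy zt; apply: (@vle_trans _ _ (y + z)); first exact: vle_addr.
by rewrite ![y + _]addrC; exact: vle_addr.
Qed.

Lemma vle_subr x y : vle x y <-> vle 0 (y - x).
Proof.
split=> [/(@vle_addr _ _ (- x))|/(@vle_addr _ _ x)]; first by rewrite subrr.
by rewrite add0r subrK.
Qed.

Lemma vleN x y : vle x y -> vle (- y) (- x).
Proof. by move=> /vle_subr h; apply/vle_subr; rewrite opprK addrC. Qed.

Lemma vleZ a x y : 0 <= a -> vle x y -> vle (a *: x) (a *: y).
Proof.
move=> a0 /vle_subr xy; apply/vle_subr.
by rewrite -scalerBr; exact: vle_scale.
Qed.

Lemma vleZr (a b : R) x : a <= b -> vle 0 x -> vle (a *: x) (b *: x).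
Proof.
move=> ab x0; apply/vle_subr; rewrite -scalerBl; apply: vle_scale => //.
by rewrite subr_ge0.
Qed.

Lemma vsup_ub x y : vle x (vsup x y) /\ vle y (vsup x y).
Proof. by apply/vsup_le; exact: vle_refl. Qed.

Lemma vinf_lb x y : vle (vinf x y) x /\ vle (vinf x y) y.
Proof. by apply/vinf_ge; exact: vle_refl. Qed.

Lemma vsup_r x y : vle x y -> vsup x y = y.
Proof.
move=> xy; apply: vle_anti; last exact: (vsup_ub _ _).2.
by apply/vsup_le; split=> //; exact: vle_refl.
Qed.

Lemma vsupC x y : vsup x y = vsup y x.
Proof.
by apply: vle_anti; apply/vsup_le; split;
  [exact: (vsup_ub _ _).2|exact: (vsup_ub _ _).1
  |exact: (vsup_ub _ _).2|exact: (vsup_ub _ _).1].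
Qed.

Lemma vsup_addr x y z : vsup (x + z) (y + z) = vsup x y + z.
Proof.
apply: vle_anti.
  by apply/vsup_le; split; apply: vle_addr; have [] := vsup_ub x y.
have [hx hy] := vsup_ub (x + z) (y + z).
rewrite -[X in vle _ X](subrK z); apply: vle_addr; apply/vsup_le.
by split; rewrite -[X in vle X _](addrK z); exact: vle_addr.
Qed.

Lemma vinf_vsup x y : vinf x y = - vsup (- x) (- y).
Proof.
apply: vle_anti.
  rewrite -[vinf x y]opprK; apply/vleN/vsup_le.
  by split; apply/vleN; have [] := vinf_lb x y.
apply/vinf_ge; have [hx hy] := vsup_ub (- x) (- y).
by split; [rewrite -[X in vle _ X](opprK x)|rewrite -[X in vle _ X](opprK y)];
  exact: vleN.
Qed.

Lemma vabs_ge x : vle x (vabs x) /\ vle (- x) (vabs x).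
Proof. exact: vsup_ub. Qed.

Lemma vabs_ge0 x : vle 0 (vabs x).
Proof.
have [h1 h2] := vabs_ge x.
have i0 : 0 <= 1 / 2 :> R by rewrite divr_ge0.
have := vleZ i0 (vleD h1 h2); rewrite subrr.
by rewrite scaler0 scalerDr -scalerDl -splitr scale1r.
Qed.

Lemma vabs_le x y : vle x y -> vle (- x) y -> vle (vabs x) y.
Proof. by move=> h1 h2; apply/vsup_le. Qed.

Lemma vabs_id x : vle 0 x -> vabs x = x.
Proof.
move=> x0; apply: vle_anti; last exact: (vabs_ge x).1.
apply: vabs_le; first exact: vle_refl.
by apply: vle_trans (x0); have := vleN x0; rewrite oppr0.
Qed.

Lemma vsup_ge0 x y : vle 0 x -> vle 0 (vsup x y).
Proof. by move=> x0; apply: vle_trans x0 _; exact: (vsup_ub _ _).1. Qed.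

Lemma vle0D x y : vle 0 x -> vle 0 y -> vle 0 (x + y).
Proof. by move=> x0 y0; rewrite -[0]addr0; exact: vleD. Qed.

End VectorLatticeBasics.

Section BanachLatticeBasics.
Variables (R : realType) (X : banachLatticeType R).
Implicit Types (x y z : X) (a : R).

Lemma norm_vabs x : `|vabs x| = `|x|.
Proof.
have E : vabs (vabs x) = vabs x by rewrite vabs_id//; exact: vabs_ge0.
by apply/le_anti/andP; split; apply: vabs_norm_le; rewrite E; exact: vle_refl.
Qed.

Lemma norm_vle x y : vle 0 x -> vle x y -> `|x| <= `|y|.
Proof.
move=> x0 xy; apply: vabs_norm_le; rewrite !vabs_id//.
exact: vle_trans x0 xy.
Qed.

Lemma norm_vle_abs x y : vle x y -> vle (- x) y -> `|x| <= `|y|.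
Proof.
move=> h1 h2; rewrite -norm_vabs; apply: norm_vle; first exact: vabs_ge0.
exact: vabs_le.
Qed.

(** The norm of the negative part of [x] is at most [|x - y|] for every [y >= 0],
    so that an element that is approximable by positive ones is positive. *)
Lemma vle0_closed x :
  (forall e, 0 < e -> exists2 y, vle 0 y & `|x - y| <= e) -> vle 0 x.
Proof.
move=> H; set n := vsup (- x) 0.
have n0 : vle 0 n by exact: (vsup_ub _ _).2.
suff n_eq0 : n = 0.
  have := (vsup_ub (- x + x) (0 + x)).1.
  by rewrite vsup_addr -/n n_eq0 addNr !add0r.
apply/eqP; rewrite -normr_eq0; apply/eqP/le_anti; rewrite normr_ge0 andbT.
apply/ler_addgt0Pl => e /H[y y0 xy]; rewrite addr0.
apply: le_trans xy; rewrite -[leRHS]norm_vabs.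
apply: norm_vle => //; apply/vsup_le; split.
  apply: vle_trans (vabs_ge _).2; rewrite opprB -[X in vle X _]add0r.
  exact: vle_addr.
exact: vabs_ge0.
Qed.

(** [a e - x >= 0] tends to [- x] as [a] decreases to [0]. *)
Lemma vle_archi x e : (forall a, 0 < a -> vle x (a *: e)) -> vle x 0.
Proof.
move=> H; rewrite -[x]opprK -[X in vle _ X]oppr0; apply/vleN/vle0_closed => d d0.
have p0 : 0 < `|e| + 1 by rewrite ltr_wpDl.
exists ((d / (`|e| + 1)) *: e - x).
  by apply/(vle_subr x)/H; rewrite divr_gt0.
rewrite opprB addrA addNr add0r.
rewrite normrN normrZ gtr0_norm ?divr_gt0// mulrAC ler_pdivrMr// ler_pM2l//.
by rewrite lerDl.
Qed.

End BanachLatticeBasics.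

Section SublatticeHom.
Variables (R : realType) (U V : vectorLatticeType R) (A : set U) (h : U -> V).
Hypotheses (slA : sublattice A) (hh : lattice_hom_on A h).
Implicit Types (u v : U) (a : R).

Lemma sublattice0 : A 0. Proof. by case: slA. Qed.

Lemma sublattice_lin a u v : A u -> A v -> A (a *: u + v).
Proof. by case: slA => _ H _ _ ? ?; apply: H. Qed.

Lemma sublatticeZ a u : A u -> A (a *: u).
Proof.
by move=> Au; rewrite -[_ *: _]addr0; apply: sublattice_lin sublattice0.
Qed.

Lemma sublatticeN u : A u -> A (- u).
Proof. by rewrite -scaleN1r; exact: sublatticeZ. Qed.

Lemma sublatticeD u v : A u -> A v -> A (u + v).
Proof. by move=> Au Av; rewrite -[u]scale1r; exact: sublattice_lin. Qed.

Lemma sublattice_vsup u v : A u -> A v -> A (vsup u v).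
Proof. by case: slA => _ _ H _ ? ?; apply: H. Qed.

Lemma sublattice_vinf u v : A u -> A v -> A (vinf u v).
Proof. by case: slA => _ _ _ H ? ?; apply: H. Qed.

Lemma sublattice_vabs u : A u -> A (vabs u).
Proof. by move=> Au; apply: sublattice_vsup => //; exact: sublatticeN. Qed.

Lemma sublattice_sum (I : Type) (r : seq I) (f : I -> U) :
  (forall i, A (f i)) -> A (\sum_(i <- r) f i).
Proof.
by move=> Af; elim/big_ind: _ => //; [exact: sublattice0|exact: sublatticeD].
Qed.

Lemma hom_lin a u v : A u -> A v -> h (a *: u + v) = a *: h u + h v.
Proof. by case: hh => H _ _ ? ?; apply: H. Qed.

Lemma hom_vsup u v : A u -> A v -> h (vsup u v) = vsup (h u) (h v).
Proof. by case: hh => _ H _ ? ?; apply: H. Qed.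

Lemma hom_vinf u v : A u -> A v -> h (vinf u v) = vinf (h u) (h v).
Proof. by case: hh => _ _ H ? ?; apply: H. Qed.

Lemma hom0 : h 0 = 0.
Proof.
have := hom_lin 1 sublattice0 sublattice0; rewrite !scale1r addr0 => h0.
by apply/eqP; rewrite -(inj_eq (addrI (h 0))) -h0 addr0.
Qed.

Lemma homZ a u : A u -> h (a *: u) = a *: h u.
Proof.
move=> Au; have := hom_lin a Au sublattice0.
by rewrite hom0 !addr0.
Qed.

Lemma homN u : A u -> h (- u) = - h u.
Proof. by move=> Au; rewrite -scaleN1r homZ// scaleN1r. Qed.

Lemma homD u v : A u -> A v -> h (u + v) = h u + h v.
Proof. by move=> Au Av; have := hom_lin 1 Au Av; rewrite !scale1r. Qed.

Lemma hom_vabs u : A u -> h (vabs u) = vabs (h u).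
Proof. by move=> Au; rewrite hom_vsup ?homN//; exact: sublatticeN. Qed.

Lemma hom_sum (I : Type) (r : seq I) (f : I -> U) :
  (forall i, A (f i)) -> h (\sum_(i <- r) f i) = \sum_(i <- r) h (f i).
Proof.
move=> Af; elim: r => [|i r IH]; first by rewrite !big_nil hom0.
by rewrite !big_cons homD ?IH//; exact: sublattice_sum.
Qed.

Lemma hom_vle u v : A u -> A v -> vle u v -> vle (h u) (h v).
Proof.
by move=> Au Av /vsup_r uv; rewrite -uv hom_vsup//; exact: (vsup_ub _ _).1.
Qed.

End SublatticeHom.

Lemma sublatticeT (R : realType) (U : vectorLatticeType R) :
  sublattice [set: U].
Proof. by []. Qed.

Lemma vabs_real (R : realType) (x : R^o) : vabs x = `|x : R| :> R.
Proof.
rewrite /vabs -[vsup x (- x)]/(Num.max (x : R) (- x)).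
by case: (ger0P (x : R)) => ?; [rewrite max_l|rewrite max_r]; lra.
Qed.

Lemma vle_sum (R : realType) (X : vectorLatticeType R) (I : finType)
    (x : I -> X) i : (forall j, vle 0 (x j)) -> vle (x i) (\sum_j x j).
Proof.
move=> x0; rewrite (bigD1 i)//= -[X in vle X _]addr0.
apply: vleD; first exact: vle_refl.
by elim/big_ind: _ => //; [exact: vle_refl|exact: vle0D].
Qed.

(** * Lattice homomorphisms from minimal gauges *)

Section MaximumGauges.
Variables (R : realType) (X : vectorLatticeType R) (A : set X).
Hypothesis slA : sublattice A.
Implicit Types (x y u : X) (a e : R) (p q : X -> R).

Let A0 : A 0. Proof. exact: (sublattice0 slA). Qed.
Let AZ a x : A x -> A (a *: x). Proof. exact: (sublatticeZ slA). Qed.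
Let AD x y : A x -> A y -> A (x + y). Proof. exact: (sublatticeD slA). Qed.
Let AN x : A x -> A (- x). Proof. exact: (sublatticeN slA). Qed.
Let AS x y : A x -> A y -> A (vsup x y). Proof. exact: (sublattice_vsup slA). Qed.

(** The model is [f |-> sup_S f] on [C(K)], for a closed subset [S] of [K]: the
    smaller [S], the smaller the gauge, and when [S] is a point the gauge is a
    lattice homomorphism. *)
Definition max_gauge p : Prop :=
  [/\ forall x y, A x -> A y -> p (x + y) <= p x + p y,
      forall a x, 0 <= a -> A x -> p (a *: x) <= a * p x
    & forall x y, A x -> A y -> p (vsup x y) <= Num.max (p x) (p y)].

Lemma max_gauge0 p : max_gauge p -> p 0 = 0.
Proof.
case=> pD pZ _; apply/le_anti/andP; split.
  by have := pZ 0 0 (lexx _) A0; rewrite scale0r mul0r.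
by have := pD 0 0 A0 A0; rewrite addr0; lra.
Qed.

Lemma max_gaugeN p x : max_gauge p -> A x -> - p (- x) <= p x.
Proof.
move=> gp Ax; have := max_gauge0 gp; case: gp => pD _ _.
by have := pD x (- x) Ax (AN Ax); rewrite subrr; lra.
Qed.

(** The defining inequalities of a gauge pass to the infimum as soon as each of
    them holds up to a change of the member of the family. *)
Lemma max_gauge_inf (C : set (X -> R)) :
  C !=set0 ->
  (forall x, A x -> exists b, forall p, C p -> b <= p x) ->
  (forall p q, C p -> C q -> exists r,
     C r /\ forall x, A x -> r x <= p x /\ r x <= q x) ->
  (forall p x y, C p -> A x -> A y ->
     exists q, C q /\ q (x + y) <= p x + p y) ->
  (forall p a x, C p -> 0 <= a -> A x ->
     exists q, C q /\ q (a *: x) <= a * p x) ->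
  (forall p x y, C p -> A x -> A y ->
     exists q, C q /\ q (vsup x y) <= Num.max (p x) (p y)) ->
  max_gauge (fun x => inf [set p x | p in C]) /\
  (forall p x, C p -> A x -> inf [set p x | p in C] <= p x).
Proof.
move=> C0 Cb Cdir CD CZ CS; set q := fun x => _.
have q_le p x : C p -> A x -> q x <= p x.
  move=> Cp Ax; have [b hb] := Cb x Ax.
  by apply: ge_inf; [exists b => _ [r Cr <-]; exact: hb|exists p].
have q_lt x e : A x -> 0 < e -> exists2 p, C p & p x < q x + e.
  move=> Ax e0; have [b hb] := Cb x Ax; have [p0 Cp0] := C0.
  have hi : has_inf [set p x | p in C].
    by split; [exists (p0 x), p0|exists b => _ [r Cr <-]; exact: hb].
  by have [_ [p Cp <-] pe] := inf_adherent e0 hi; exists p.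
have q_lt2 x y e : A x -> A y -> 0 < e ->
    exists p, [/\ C p, p x <= q x + e & p y <= q y + e].
  move=> Ax Ay e0; have [p Cp pe] := q_lt x e Ax e0.
  have [r Cr re] := q_lt y e Ay e0; have [s [Cs sle]] := Cdir _ _ Cp Cr.
  have [[spx _] [_ sry]] := (sle x Ax, sle y Ay).
  by exists s; split=> //; lra.
split=> //; split.
- move=> x y Ax Ay; apply/ler_addgt0Pl => e e0.
  have e2 : 0 < e / 2 by lra.
  have [p [Cp px py]] := q_lt2 x y _ Ax Ay e2.
  have [r [Cr rxy]] := CD p x y Cp Ax Ay.
  by have := q_le r (x + y) Cr (AD Ax Ay); lra.
- move=> a x a0 Ax; apply/ler_addgt0Pl => e e0.
  have e2 : 0 < e / (a + 1) by rewrite divr_gt0//; lra.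
  have [p [Cp px _]] := q_lt2 x x _ Ax Ax e2.
  have [r [Cr rax]] := CZ p a x Cp a0 Ax.
  apply: (le_trans (q_le r _ Cr (AZ _ Ax))); apply: (le_trans rax).
  apply: (@le_trans _ _ (a * (q x + e / (a + 1)))); first by rewrite ler_wpM2l.
  rewrite mulrDr addrC lerD2r mulrCA -[leRHS]mulr1 ler_pM2l//.
  by rewrite ler_pdivrMr; lra.
move=> x y Ax Ay; apply/ler_addgt0Pl => e e0.
have [p [Cp px py]] := q_lt2 x y _ Ax Ay e0.
have [r [Cr rxy]] := CS p x y Cp Ax Ay.
apply: (le_trans (q_le r _ Cr (AS Ax Ay))); apply: (le_trans rxy).
rewrite addrC ge_max; apply/andP; split.
  by apply: (le_trans px); rewrite lerD2r le_max lexx.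
by apply: (le_trans py); rewrite lerD2r le_max lexx orbT.
Qed.

(** The directional derivative of [p] at infinity along [u] is a smaller gauge
    that is linear on the line of [u]; for [p = sup_S] on [C(K)] it is the
    supremum over the part of [S] where [u] is largest. *)
Lemma max_gauge_peak p u : max_gauge p -> A u ->
  exists q, [/\ max_gauge q, forall x, A x -> q x <= p x & q (- u) <= - p u].
Proof.
move=> gp Au; have p0 := max_gauge0 gp; have [pD pZ pS] := gp.
pose f t x := p (x + t *: u) - t * p u.
have Axt x t : A x -> A (x + t *: u) by move=> Ax; apply: AD => //; exact: AZ.
have f_anti s t x : A x -> s <= t -> f t x <= f s x.
  move=> Ax st; rewrite /f.
  have -> : x + t *: u = (x + s *: u) + (t - s) *: u.
    by rewrite scalerBl -addrA [s *: u + _]addrC subrK.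
  have := pD _ _ (Axt x s Ax) (AZ (t - s) Au).
  have ts0 : 0 <= t - s by lra.
  by have := pZ _ _ ts0 Au; lra.
have A00 : 0 <= 0 :> R by [].
have [||||||gq q_le] := @max_gauge_inf [set f t | t in [set t | 0 <= t]].
- by exists (f 0), 0.
- move=> x Ax; exists (- p (- x)) => _ [t /= t0 <-]; rewrite /f.
  have := pD _ _ (Axt x t Ax) (AN Ax); rewrite addrAC subrr add0r.
  have [->|tn0] := eqVneq t 0; first by rewrite scale0r p0 mul0r; lra.
  have tp : 0 < t by rewrite lt_neqAle eq_sym tn0.
  have ti : 0 <= t^-1 by rewrite invr_ge0.
  have := pZ _ _ ti (AZ t Au); rewrite scalerA mulVf// scale1r.
  by rewrite mulrC ler_pdivlMr// mulrC; lra.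
- move=> _ _ [s /= s0 <-] [t /= t0 <-].
  exists (f (Num.max s t)); split.
    by exists (Num.max s t) => //=; rewrite le_max s0.
  by move=> x Ax; split; apply: f_anti => //; rewrite le_max lexx ?orbT.
- move=> _ x y [t /= t0 <-] Ax Ay; exists (f (t + t)); split.
    by exists (t + t) => //=; rewrite addr_ge0.
  rewrite /f scalerDl addrACA.
  by have := pD _ _ (Axt x t Ax) (Axt y t Ay); lra.
- move=> _ a x [t /= t0 <-] a0 Ax; exists (f (a * t)); split.
    by exists (a * t) => //=; rewrite mulr_ge0.
  rewrite /f -scalerA -scalerDr mulrBr mulrA lerD2r.
  exact: pZ (Axt x t Ax).
- move=> _ x y [t /= t0 <-] Ax Ay; exists (f t); split; first by exists t.
  rewrite /f -vsup_addr; have := pS _ _ (Axt x t Ax) (Axt y t Ay).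
  by rewrite !le_max => /orP[h|h]; apply/orP; [left|right]; rewrite lerD2r.
exists (fun x => inf [set g x | g in [set f t | t in [set t | 0 <= t]]]).
split=> // [x Ax|].
  apply: (le_trans (q_le (f 0) x _ Ax)); first by exists 0.
  by rewrite /f scale0r addr0 mul0r subr0.
apply: (le_trans (q_le (f 1) _ _ (AN Au))); first by exists 1 => //=.
by rewrite /f scale1r addNr p0 mul1r sub0r.
Qed.
(** Zorn's lemma yields a minimal gauge below the peak of [p] along [u]; since it
    coincides with its own peaks, it is linear along every direction. *)
Lemma max_gauge_lattice_hom p u :
  max_gauge p -> (forall x, A x -> vle x 0 -> p x <= 0) -> A u ->
  exists tau : X -> R^o,
    [/\ lattice_hom_on A tau, forall x, A x -> tau x <= p x & tau u = p u].
Proof.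
move=> gp p_le0 Au; have [p1 [gp1 p1p p1u]] := max_gauge_peak gp Au.
pose good q := max_gauge q /\ forall x, A x -> q x <= p1 x.
pose T := {q : X -> R | good q}.
pose below (q r : T) := `[< forall x, A x -> sval r x <= sval q x >].
have t0 : T by exists p1.
have [||C Ctot|[tau [gt tp1]] tmin] := @ZL_preorder T t0 below.
- by move=> q; apply/asboolP.
- move=> q r s /asboolP rq /asboolP qs; apply/asboolP => x Ax.
  exact: le_trans (qs x Ax) (rq x Ax).
- have [C0|/set0P[q0 Cq0]] := eqVneq C set0.
    by exists t0 => s; rewrite C0.
  have [||||||gq q_le] := @max_gauge_inf [set sval q | q in C].
  + by exists (sval q0), q0.
  + move=> x Ax; exists (- p1 (- x)) => _ [[q [gq qp1]] _ <-] /=.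
    by have := max_gaugeN gq Ax; have := qp1 _ (AN Ax); lra.
  + move=> _ _ [q Cq <-] [r Cr <-].
    case: (Ctot q r Cq Cr) => /asboolP h; [exists (sval r)|exists (sval q)].
      by split=> [|x Ax]; [exists r|split=> //; exact: h].
    by split=> [|x Ax]; [exists q|split=> //; exact: h].
  + move=> _ x y [q Cq <-] Ax Ay; exists (sval q).
    by split; [exists q|case: (svalP q) => -[qD _ _] _; exact: qD].
  + move=> _ a x [q Cq <-] a0 Ax; exists (sval q).
    by split; [exists q|case: (svalP q) => -[_ qZ _] _; exact: qZ].
  + move=> _ x y [q Cq <-] Ax Ay; exists (sval q).
    by split; [exists q|case: (svalP q) => -[_ _ qS] _; exact: qS].
  have qp1 x (Ax : A x) : inf [set g x | g in [set sval q | q in C]] <= p1 x.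
    apply: (le_trans (q_le (sval q0) x _ Ax)); first by exists q0.
    exact: (svalP q0).2.
  exists (exist good _ (conj gq qp1)) => s Cs; apply/asboolP => x Ax /=.
  by apply: q_le => //; exists s.
have tN x : A x -> tau (- x) = - tau x.
  move=> Ax; have [q [gq qt qx]] := max_gauge_peak gt Ax.
  have qp1 y : A y -> q y <= p1 y by move=> Ay; exact: le_trans (qt y Ay) (tp1 y Ay).
  have /asboolP/(_ _ (AN Ax))/= h :
      below (exist good q (conj gq qp1)) (exist good tau (conj gt tp1)).
    by apply: tmin; apply/asboolP.
  by have := max_gaugeN gt Ax; lra.
have [tD tZ tS] := gt.
have tadd x y : A x -> A y -> tau (x + y) = tau x + tau y.
  move=> Ax Ay; have := tD _ _ (AN Ax) (AN Ay).
  by have := tD _ _ Ax Ay; rewrite -opprD !tN//; [lra|exact: AD].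
have tscale0 a x : 0 <= a -> A x -> tau (a *: x) = a * tau x.
  move=> a0 Ax; have := tZ _ _ a0 (AN Ax).
  by have := tZ _ _ a0 Ax; rewrite scalerN !tN//; [lra|exact: AZ].
have tscale a x : A x -> tau (a *: x) = a * tau x.
  move=> Ax; have [a0|a0] := leP 0 a; first exact: tscale0.
  rewrite -[a]opprK scaleNr tN; last exact: AZ.
  by rewrite tscale0//; [lra|lra].
have tp x : A x -> tau x <= p x by move=> Ax; exact: le_trans (tp1 x Ax) (p1p x Ax).
have tmono x y : A x -> A y -> vle x y -> tau x <= tau y.
  move=> Ax Ay xy; have xy0 : vle (x - y) 0.
    by have := @vle_addr _ _ (- y) _ _ xy; rewrite subrr.
  have := p_le0 _ (AD Ax (AN Ay)) xy0; have := tp _ (AD Ax (AN Ay)).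
  by rewrite tadd ?tN//; [lra|exact: AN].
have tsup x y : A x -> A y -> tau (vsup x y) = Num.max (tau x) (tau y).
  move=> Ax Ay; apply/le_anti; rewrite tS//= ge_max.
  by apply/andP; split; apply: tmono => //; try exact: AS;
    have [] := vsup_ub x y.
exists tau; split=> //.
- split=> //.
  + by move=> a x y Ax Ay; rewrite tadd ?tscale//; exact: AZ.
  + move=> x y Ax Ay; rewrite vinf_vsup tN; last by apply: AS; exact: AN.
    by rewrite tsup ?tN -?oppr_min ?opprK//; exact: AN.
by apply/le_anti; rewrite tp//=; have := tp1 _ (AN Au); rewrite tN//; lra.
Qed.

End MaximumGauges.

(** * Principal ideals and transfer of inequalities from the real numbers *)

Section PrincipalIdeal.
Variables (R : realType) (X : banachLatticeType R) (e : X).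
Hypothesis e0 : vle 0 e.
Implicit Types (x y : X) (a l : R).

(** The ideal generated by [e], on which [e] is an order unit. *)
Definition ideal : set X :=
  [set x | exists l, [/\ 0 <= l, vle x (l *: e) & vle (- x) (l *: e)]].

Lemma ideal_vle x y : ideal y -> vle x y -> vle (- x) y -> ideal x.
Proof.
by move=> [l [l0 yl _]] xy xNy; exists l; split=> //; exact: vle_trans yl.
Qed.

Lemma ideal_norm : ideal e.
Proof.
exists 1; rewrite scale1r; split=> //; first exact: vle_refl.
by apply: vle_trans e0; have := vleN e0; rewrite oppr0.
Qed.

Lemma sublattice_ideal : sublattice ideal.
Proof.
have iN x : ideal x -> ideal (- x).
  by move=> [l [l0 x1 x2]]; exists l; split; rewrite ?opprK.
have iD x y : ideal x -> ideal y -> ideal (x + y).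
  move=> [l [l0 x1 x2]] [k [k0 y1 y2]]; exists (l + k); rewrite addr_ge0//.
  by split=> //; rewrite ?opprD scalerDl; exact: vleD.
have iZ a x : ideal x -> ideal (a *: x).
  wlog a0 : a / 0 <= a => [hw|] ix.
    have [/hw|a0] := leP 0 a; first exact.
    by rewrite -[a]opprK scaleNr; apply/iN/hw => //; rewrite oppr_ge0 ltW.
  case: ix => l [l0 x1 x2]; exists (a * l); rewrite mulr_ge0// -scalerA.
  by split=> //; rewrite -?scalerN; exact: vleZ.
have iS x y : ideal x -> ideal y -> ideal (vsup x y).
  move=> [l [l0 x1 x2]] [k [k0 y1 y2]]; exists (l + k); split.
  - by rewrite addr_ge0.
  - apply/vsup_le; split; rewrite scalerDl.
      by rewrite -[x]addr0; apply: vleD => //; exact: vle_scale.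
    by rewrite -[y]add0r; apply: vleD => //; exact: vle_scale.
  - apply: (@vle_trans _ _ (- x)); first by apply/vleN; exact: (vsup_ub _ _).1.
    by rewrite scalerDl -[- x]addr0; apply: vleD => //; exact: vle_scale.
split=> //.
- by exists 0; rewrite scale0r oppr0; split=> //; exact: vle_refl.
- by move=> a x y ix iy; apply: iD => //; exact: iZ.
- move=> x y ix iy; rewrite vinf_vsup; apply/(iN _)/iS; exact: iN.
Qed.

Let upper x : set R := [set l | 0 <= l /\ vle x (l *: e)].

Let sharp x := inf (upper x).

Let sharp_le x l : 0 <= l -> vle x (l *: e) -> sharp x <= l.
Proof. by move=> l0 xl; apply: ge_inf; [exists 0 => k []|]. Qed.

Let sharp_ge0 x : ideal x -> 0 <= sharp x.
Proof.
by move=> [l [l0 xl _]]; apply: lb_le_inf; [exists l|move=> k []].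
Qed.

(* The infimum is attained because the order is Archimedean. *)
Let vle_sharp x : ideal x -> vle x (sharp x *: e).
Proof.
move=> [l [l0 xl _]]; have hi : has_inf (upper x).
  by split; [exists l|exists 0 => k []].
apply/vle_subr; rewrite -[sharp x *: e - x]opprB -oppr0; apply/vleN.
apply: (@vle_archi _ _ _ e) => d d0; have [k [k0 xk] kd] := inf_adherent d0 hi.
apply: (@vle_trans _ _ (k *: e - sharp x *: e)); first exact: vle_addr.
by rewrite -scalerBl; apply: vleZr => //; rewrite lerBlDr addrC ltW.
Qed.

Let max_gauge_sharp : max_gauge ideal sharp.
Proof.
have [_ _ iS _] := sublattice_ideal.
split.
- move=> x y ix iy; apply: sharp_le; first by rewrite addr_ge0 ?sharp_ge0.
  by rewrite scalerDl; apply: vleD; exact: vle_sharp.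
- move=> a x a0 ix; apply: sharp_le; first by rewrite mulr_ge0 ?sharp_ge0.
  by rewrite -scalerA; apply: vleZ => //; exact: vle_sharp.
move=> x y ix iy; apply: sharp_le; first by rewrite le_max sharp_ge0.
by apply/vsup_le; split; (apply: vle_trans (vle_sharp _) _ => //);
  apply: vleZr => //; rewrite le_max lexx ?orbT.
Qed.

(** The gauge [x |-> inf {l >= 0 | x <= l e}] is positive at every [x] that is
    not [<= 0], and so is some lattice homomorphism below it. *)
Lemma ideal_hom_vle0 x : ideal x ->
  (forall tau : X -> R^o, lattice_hom_on ideal tau -> 0 <= (tau x : R)) ->
  vle 0 x.
Proof.
move=> ix H; have sl := sublattice_ideal.
have iNx : ideal (- x) := sublatticeN sl ix.
have [|tau [ht _ tx]] := max_gauge_lattice_hom sl max_gauge_sharp _ iNx.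
  by move=> y iy y0; apply: sharp_le => //; rewrite scale0r.
have s0 : sharp (- x) = 0.
  apply/le_anti; rewrite sharp_ge0// andbT -tx (homN sl ht)// oppr_le0.
  exact: H.
by have := vleN (vle_sharp iNx); rewrite s0 scale0r opprK oppr0.
Qed.

Lemma ideal_hom_vle x y : ideal x -> ideal y ->
  (forall tau : X -> R^o, lattice_hom_on ideal tau ->
     (tau x : R) <= tau y) ->
  vle x y.
Proof.
move=> ix iy H; apply/vle_subr; have sl := sublattice_ideal.
have iNx := sublatticeN sl ix.
apply: ideal_hom_vle0 => [|tau ht]; first exact: sublatticeD.
by rewrite (homD ht)// (homN sl ht)// subr_ge0; exact: H.
Qed.

Lemma ideal_hom_eq x y : ideal x -> ideal y ->
  (forall tau : X -> R^o, lattice_hom_on ideal tau -> tau x = tau y) ->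
  x = y.
Proof.
by move=> ix iy H; apply: vle_anti; apply: ideal_hom_vle => // tau ht; rewrite H.
Qed.

End PrincipalIdeal.

Section Transfer.
Variable R : realType.

(** Formal lattice-linear expressions; an inequality between two of them that
    holds for real numbers holds in every Banach lattice. *)
Inductive lterm : Type :=
| LVar of nat
| LScale of R & lterm
| LAdd of lterm & lterm
| LSup of lterm & lterm
| LInf of lterm & lterm.

Fixpoint leval (X : vectorLatticeType R) (x : seq X) (t : lterm) : X :=
  match t with
  | LVar i => nth 0 x i
  | LScale a t => a *: leval x t
  | LAdd s t => leval x s + leval x t
  | LSup s t => vsup (leval x s) (leval x t)
  | LInf s t => vinf (leval x s) (leval x t)
  end.

(** The evaluation in the vector lattice of real numbers, with the operations
    spelled out for the decision procedures of ordered fields. *)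
Fixpoint reval (x : seq R) (t : lterm) : R :=
  match t with
  | LVar i => nth 0 x i
  | LScale a t => a * reval x t
  | LAdd s t => reval x s + reval x t
  | LSup s t => Num.max (reval x s) (reval x t)
  | LInf s t => Num.min (reval x s) (reval x t)
  end.

Variable X : banachLatticeType R.
Implicit Types (x : seq X) (s t : lterm).

(** All the terms live in the ideal generated by the absolute values of the
    variables, whose order is determined by real lattice homomorphisms; these
    are monotone and commute with the evaluation of terms. *)
Lemma leval_vle x (P : set lterm) s t :
  (forall h, P h -> vle 0 (leval x h)) ->
  (forall r : seq R, size r = size x -> (forall h, P h -> 0 <= reval r h) ->
     reval r s <= reval r t) ->
  vle (leval x s) (leval x t).
Proof.
move=> Px H; pose e : X := \sum_(y <- x) vabs y.
have sum0 (z : seq X) : vle 0 (\sum_(y <- z) vabs y).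
  elim: z => [|y z IH]; first by rewrite big_nil; exact: vle_refl.
  by rewrite big_cons; apply: vle0D => //; exact: vabs_ge0.
have e0 : vle 0 e by exact: sum0.
have sl := sublattice_ideal e0.
have iabs y : y \in x -> ideal e y.
  move=> yx; have ye : vle (vabs y) e.
    rewrite /e; elim: x yx {Px H e e0 sl} => // z w IH.
    rewrite inE big_cons => /predU1P[->|/IH h].
      by rewrite -[X in vle X _]addr0; apply: vleD (sum0 w); exact: vle_refl.
    by rewrite -[X in vle X _]add0r; apply: vleD h; exact: vabs_ge0.
  have [h1 h2] := vabs_ge y.
  by apply: (ideal_vle (ideal_norm e0)); apply: vle_trans ye.
have ivar u : ideal e (leval x u).
  elim: u => [i|a u IH|u IHu v IHv|u IHu v IHv|u IHu v IHv] /=.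
  - have [ix|ix] := ltnP i (size x); first by apply: iabs; exact: mem_nth.
    by rewrite nth_default//; exact: sublattice0.
  - exact: sublatticeZ.
  - exact: sublatticeD.
  - exact: sublattice_vsup.
  - exact: sublattice_vinf.
apply: (ideal_hom_vle e0) => // tau ht.
have tE u : tau (leval x u) = reval (map tau x) u :> R.
  elim: u => [i|a u IH|u IHu v IHv|u IHu v IHv|u IHu v IHv] /=.
  - have [ix|ix] := ltnP i (size x); first by rewrite (nth_map 0).
    by rewrite !nth_default ?size_map//; exact: hom0 sl ht.
  - by rewrite (homZ sl ht)// IH.
  - by rewrite (homD ht)// IHu IHv.
  - by rewrite (hom_vsup ht)// IHu IHv.
  - by rewrite (hom_vinf ht)// IHu IHv.
rewrite !tE; apply: H => [|h /Px h0]; first by rewrite size_map.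
rewrite -tE -[X in X <= _](hom0 sl ht).
by apply: (hom_vle ht) => //; exact: sublattice0.
Qed.

Lemma leval_vle_pos x s t :
  (forall i, vle 0 (nth 0 x i)) ->
  (forall r : seq R, size r = size x -> (forall i, 0 <= nth 0 r i) ->
     reval r s <= reval r t) ->
  vle (leval x s) (leval x t).
Proof.
move=> x0 H; apply: (@leval_vle x (range LVar)) => [_ [i _ <-]|r sr r0].
  exact: x0.
by apply: H => // i; exact: (r0 (LVar i)).
Qed.

End Transfer.

(** * Norms that are maximal on disjoint elements *)

(* Splits innermost maxima and minima first, so that the comparisons produced
   are between linear expressions. *)
Ltac split_max_min :=
  repeat match goal with
  | |- context [Order.max ?a ?b] =>
    lazymatch constr:((a, b)) with
    | context [Order.max] => fail
    | context [Order.min] => fail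
    | _ => case: (leP a b) => ?
    end
  | |- context [Order.min ?a ?b] =>
    lazymatch constr:((a, b)) with
    | context [Order.max] => fail
    | context [Order.min] => fail
    | _ => case: (leP a b) => ?
    end
  end.

Section PositivePart.
Variables (R : realType) (X : banachLatticeType R).
Implicit Types (x y z : X) (a l : R).

Lemma vsup0D x y : vle (vsup (x + y) 0) (vsup x 0 + vsup y 0).
Proof.
pose x1 := LVar R 0; pose y1 := LVar R 1; pose o := LScale 0 x1.
have := @leval_vle R X [:: x; y] set0 (LSup (LAdd x1 y1) o)
  (LAdd (LSup x1 o) (LSup y1 o)).
rewrite /= scale0r; apply=> // -[|a [|b []]]//= _ _; rewrite mul0r.
by split_max_min; lra.
Qed.

Lemma vsup0_vsup x y : vsup (vsup x y) 0 = vsup (vsup x 0) (vsup y 0).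
Proof.
apply: vle_anti; repeat (apply/vsup_le; split).
- by apply: vle_trans (vsup_ub _ _).1; exact: (vsup_ub _ _).1.
- by apply: vle_trans (vsup_ub _ _).2; exact: (vsup_ub _ _).1.
- by apply: vle_trans (vsup_ub _ _).2; exact: (vsup_ub _ _).2.
- by apply: vle_trans (vsup_ub _ _).1; exact: (vsup_ub _ _).1.
- exact: (vsup_ub _ _).2.
- by apply: vle_trans (vsup_ub _ _).1; exact: (vsup_ub _ _).2.
- exact: (vsup_ub _ _).2.
Qed.

Lemma vsup0Z a x : 0 <= a -> vle (vsup (a *: x) 0) (a *: vsup x 0).
Proof.
move=> a0; apply/vsup_le; split; first by apply: vleZ => //; exact: (vsup_ub _ _).1.
by apply: vle_scale => //; exact: (vsup_ub _ _).2.
Qed.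

Lemma vinfDl_le x y z : vle 0 x -> vle 0 y -> vle 0 z ->
  vle (vinf (x + y) z) (vinf x z + vinf y z).
Proof.
move=> x0 y0 z0; pose v := LVar R.
have := @leval_vle_pos R X [:: x; y; z] (LInf (LAdd (v 0) (v 1)) (v 2))
  (LAdd (LInf (v 0) (v 2)) (LInf (v 1) (v 2))).
apply=> [[|[|[|i]]]//=|]; first by rewrite nth_nil; exact: vle_refl.
move=> [|a [|b [|c []]]]//= _ r0; have := r0 0%N; have := r0 1%N; have := r0 2%N.
by rewrite /=; split_max_min; lra.
Qed.

Lemma vsup_vinf_add x y : vsup x y + vinf x y = x + y.
Proof.
rewrite vinf_vsup; apply/eqP; rewrite subr_eq; apply/eqP.
have E t : x + y + t = t + (x + y) by rewrite addrC.
by rewrite E -vsup_addr addKr [x + y]addrC addKr; apply: vle_anti;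
  apply/vsup_le; split; have [] := vsup_ub x y; have [] := vsup_ub y x.
Qed.

Lemma vinf_ge0 x y : vle 0 x -> vle 0 y -> vle 0 (vinf x y).
Proof. by move=> *; apply/vinf_ge. Qed.

End PositivePart.

(** If [N (a - l b)] and [N (l' b - a)] were both below [m = max a b], their sum
    would give [4 b < m], so that [m = a] and [N (a - l b) >= 8 (a - 2 b) >= 4 a]
    exceeds [m]. *)
Lemma real_slices_disjoint (R : realType) (a b l l' N : R) :
  0 <= a -> 0 <= b -> 8 <= N -> l' <= 2 -> 8 <= N * (l' - l) ->
  N * (a - l * b) < Num.max a b -> Num.max a b <= N * (l' * b - a).
Proof.
move=> a0 b0 N8 l2 Nl h1; rewrite leNgt; apply/negP => h2.
have h3 := ler_wpM2r b0 Nl.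
have ll : l < l' by rewrite -subr_gt0 -(@pmulr_rgt0 _ N); lra.
have h4 : 4 * b < Num.max a b by lra.
have ab : Num.max a b = a by case: (leP a b) h4 => // ab h4; lra.
rewrite ab in h1 h4.
have h5 : (l' - l) * b >= 0 by apply: mulr_ge0; lra.
have h6 : (2 - l') * b >= 0 by apply: mulr_ge0; lra.
have h7 : 0 <= a - l * b by lra.
have N80 : 0 <= N - 8 by lra.
by have := mulr_ge0 N80 h7; lra.
Qed.

Section DisjointlyMaximalNorm.
Variables (R : realType) (X : banachLatticeType R).
Implicit Types (x y z u : X) (l N B : R).
Hypothesis disjoint_max : forall x y, vle 0 x -> vle 0 y -> vinf x y = 0 ->
  `|vsup x y| <= Num.max `|x| `|y|.

(** Partial sums stay disjoint from the next term, so that the sum is a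
    supremum of disjoint elements at every stage. *)
Let norm_disjoint_sum (c : nat -> X) n B :
  (forall i, vle 0 (c i)) -> (forall i, `|c i| <= B) ->
  (forall i j, (i < j < n)%N -> vinf (c i) (c j) = 0) -> 0 <= B ->
  `|\sum_(i < n) c i| <= B.
Proof.
move=> c0 cB cd B0.
have s0 k : vle 0 (\sum_(i < k) c i).
  by elim: k => [|k IH]; rewrite ?big_ord0 ?big_ord_recr/=;
    [exact: vle_refl|exact: vle0D].
have sd j k : (k <= j < n)%N -> vinf (\sum_(i < k) c i) (c j) = 0.
  move=> /andP[kj jn]; apply: vle_anti; last exact: vinf_ge0.
  elim: k kj => [_|k IH kj]; rewrite ?big_ord0 ?big_ord_recr/=.
    exact: (vinf_lb _ _).1.
  apply: vle_trans (vinfDl_le (s0 k) (c0 k) (c0 j)) _.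
  by rewrite -[X in vle _ X]addr0; apply: vleD; [exact: IH (ltnW kj)|
    rewrite cd ?kj//; exact: vle_refl].
have sB k : (k <= n)%N -> `|\sum_(i < k) c i| <= B.
  elim: k => [_|k IH kn]; first by rewrite big_ord0 normr0.
  have d : vinf (\sum_(i < k) c i) (c k) = 0 by rewrite sd// leqnn.
  rewrite big_ord_recr/= -vsup_vinf_add d addr0.
  by apply: (le_trans (disjoint_max _ _ d)) => //; rewrite ge_max cB IH// ltnW.
exact: sB.
Qed.

Section Slices.
Variables (x y : X) (N : R).
Hypotheses (x0 : vle 0 x) (y0 : vle 0 y) (N8 : 8 <= N).

Let N0 : 0 <= N. Proof. by apply: le_trans N8. Qed.

Let u := vsup x y.

(** The slice is the part of [u] near the set where [x = l y]; the rest of [u]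
    splits into a part where [x > l y] and a part where [x < l y]. *)
Let slice l := vsup (u - N *: vabs (x - l *: y)) 0.
Let above l := vinf u (N *: vsup (x - l *: y) 0).
Let below l := vinf u (N *: vsup (l *: y - x) 0).

Let xt := LVar R 0.
Let yt := LVar R 1.
Let zt := LScale 0 xt.
Let ut := LSup xt yt.
Let opp (t : lterm R) := LScale (-1) t.
Let wt l := LAdd xt (opp (LScale l yt)).
Let wt' l := LAdd (LScale l yt) (opp xt).
Let slicet l := LSup (LAdd ut (opp (LScale N (LSup (wt l) (opp (wt l)))))) zt.
Let abovet l := LInf ut (LScale N (LSup (wt l) zt)).
Let belowt l := LInf ut (LScale N (LSup (wt' l) zt)).

Let env0 i : vle 0 (nth 0 [:: x; y] i).
Proof. by case: i => [|[|i]] //=; rewrite nth_nil; exact: vle_refl. Qed.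

Let transfer s t :
  (forall a b : R, 0 <= a -> 0 <= b -> reval [:: a; b] s <= reval [:: a; b] t) ->
  vle (leval [:: x; y] s) (leval [:: x; y] t).
Proof.
move=> H; apply: (leval_vle_pos env0) => -[|a [|b []]]//= _ r0.
by apply: H; [exact: (r0 0%N)|exact: (r0 1%N)].
Qed.

Let sliceE l : leval [:: x; y] (slicet l) = slice l.
Proof. by rewrite /= !scaleN1r scale0r. Qed.
Let aboveE l : leval [:: x; y] (abovet l) = above l.
Proof. by rewrite /= !scaleN1r scale0r. Qed.
Let belowE l : leval [:: x; y] (belowt l) = below l.
Proof. by rewrite /= !scaleN1r scale0r. Qed.
Let ztE : leval [:: x; y] zt = 0.
Proof. by rewrite /= scale0r. Qed.

Let slice_ge0 l : vle 0 (slice l).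
Proof. exact: (vsup_ub _ _).2. Qed.

Let slice_le l : vle (slice l) u.
Proof.
apply/vsup_le; split; last exact: vsup_ge0.
rewrite -[X in vle _ X]subr0.
apply: (@vleD _ _ u u); first exact: vle_refl.
by apply/vleN; apply: vle_scale => //; exact: vabs_ge0.
Qed.

Let slice_disjoint l l' : l' <= 2 -> 8 <= N * (l' - l) ->
  vinf (slice l) (slice l') = 0.
Proof.
move=> l2 Nl; apply: vle_anti; last by apply: vinf_ge0; exact: slice_ge0.
rewrite -!sliceE -[X in vle _ X]ztE -/(leval _ (LInf (slicet l) (slicet l'))).
apply: transfer => a b a0 b0 /=; rewrite !mul0r !mulN1r.
set w := Num.max (a + _) _; set w' := Num.max (a + _) _.
have hw : N * (a - l * b) <= N * w by rewrite ler_wpM2l// le_max lexx.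
have hw' : N * (l' * b - a) <= N * w'.
  by rewrite ler_wpM2l// le_max opprB lexx orbT.
have := real_slices_disjoint a0 b0 N8 l2 Nl.
case: (ltP (N * (a - l * b)) (Num.max a b)) => [_ /(_ erefl) h|h _].
  by rewrite ge_min; apply/orP; right; rewrite ge_max lexx andbT; lra.
by rewrite ge_min; apply/orP; left; rewrite ge_max lexx andbT; lra.
Qed.

Let above_le l : 1 <= l -> vle (above l) x.
Proof.
move=> l1; rewrite -aboveE -[X in vle _ X]/(leval [:: x; y] xt).
apply: transfer => a b a0 b0 /=; rewrite mul0r mulN1r ge_min ge_max.
case: (leP b a) => [_|ab]; first by rewrite lexx.
have lb : 0 <= (l - 1) * b by apply: mulr_ge0; lra.
rewrite (max_r (_ : a - l * b <= 0)); last lra.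
by rewrite mulr0 a0 orbT.
Qed.

Let below_le l : 1 <= l -> vle (below l) (l *: y).
Proof.
move=> l1; rewrite -belowE -[X in vle _ X]/(leval [:: x; y] (LScale l yt)).
apply: transfer => a b a0 b0 /=; rewrite mul0r mulN1r ge_min ge_max.
have lb : 0 <= (l - 1) * b by apply: mulr_ge0; lra.
case: (leP a (l * b)) => [ab|ab]; first by apply/orP; left; lra.
rewrite (max_r (_ : l * b - a <= 0)); last lra.
by rewrite mulr0; apply/orP; right; lra.
Qed.

Let above_below_disjoint l : vinf (above l) (below l) = 0.
Proof.
apply: vle_anti; last first.
  apply: vinf_ge0; apply: vinf_ge0; try exact: vsup_ge0;
  by apply: vle_scale => //; exact: (vsup_ub _ _).2.
rewrite -aboveE -belowE -[X in vle _ X]ztE.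
rewrite -[X in vle X _]/(leval [:: x; y] (LInf (abovet l) (belowt l))).
apply: transfer => a b a0 b0 /=; rewrite !mul0r !mulN1r !ge_min.
case: (leP (a - l * b) 0) => h; first by rewrite mulr0 lexx !orbT.
by rewrite (max_r (_ : l * b - a <= 0)) ?mulr0 ?lexx ?orbT//; lra.
Qed.

Let above_below_slice l : vle u (vsup (above l) (below l) + slice l).
Proof.
rewrite -aboveE -belowE -sliceE -[X in vle X _]/(leval [:: x; y] ut).
rewrite -[X in vle _ X]
  /(leval [:: x; y] (LAdd (LSup (abovet l) (belowt l)) (slicet l))).
apply: transfer => a b a0 b0 /=; rewrite !mul0r !mulN1r.
have m0 : 0 <= Num.max a b by rewrite le_max a0.
move: (Num.max a b) m0 => m m0; rewrite opprB.
set w := a - l * b; rewrite -[l * b - a]opprB -/w.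
have [w0|w0] := leP 0 w.
  rewrite (max_l (_ : - w <= w)); last lra.
  rewrite (max_r (_ : - w <= 0)); last lra.
  by rewrite mulr0; move: (N * w) => q; split_max_min; lra.
rewrite (max_r (_ : w <= - w)); last lra.
rewrite (max_l (_ : 0 <= - w)); last lra.
by move: (N * - w) => q; rewrite mulr0; split_max_min; lra.
Qed.

Let norm_sub_slice l : 1 <= l -> `|u - slice l| <= l * Num.max `|x| `|y|.
Proof.
move=> l1.
have a0 : vle 0 (above l).
  apply: vinf_ge0; first exact: vsup_ge0.
  by apply: vle_scale => //; exact: (vsup_ub _ _).2.
have b0 : vle 0 (below l).
  apply: vinf_ge0; first exact: vsup_ge0.
  by apply: vle_scale => //; exact: (vsup_ub _ _).2.
have us0 : vle 0 (u - slice l) by apply: (vle_subr _ _).1; exact: slice_le.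
have M0 : 0 <= Num.max `|x| `|y| by rewrite le_max normr_ge0.
apply: (@le_trans _ _ `|vsup (above l) (below l)|).
  apply: norm_vle => //.
  have := @vle_addr _ _ (- slice l) _ _ (above_below_slice l).
  by rewrite addrK.
apply: (le_trans (disjoint_max a0 b0 (above_below_disjoint l))).
rewrite ge_max; apply/andP; split.
  apply: (le_trans (norm_vle a0 (above_le l1))).
  apply: (@le_trans _ _ (Num.max `|x| `|y|)); first by rewrite le_max lexx.
  by rewrite ler_peMl.
apply: (le_trans (norm_vle b0 (below_le l1))).
rewrite normrZ ger0_norm; last lra.
by rewrite ler_wpM2l ?le_max ?lexx ?orbT//; lra.
Qed.

(** [n u] is the sum of the [n] differences [u - slice l_i], each bounded by
    [norm_sub_slice], and of the [n] slices, whose sum is bounded by [|u|] because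
    they are disjoint and below [u]. *)
Lemma norm_vsup_slices n (l : nat -> R) B :
  (forall i, (i < n)%N -> 1 <= l i <= B) -> B <= 2 ->
  (forall i j, (i < j)%N -> 8 <= N * (l j - l i)) ->
  n%:R * `|u| <= n%:R * (B * Num.max `|x| `|y|) + `|u|.
Proof.
move=> lB B2 lN; set M := Num.max _ _.
have M0 : 0 <= M by rewrite le_max normr_ge0.
have -> : n%:R * `|u| = `|\sum_(i < n) (u - slice (l i)) + \sum_(i < n) slice (l i)|.
  rewrite -big_split/= (eq_bigr (fun=> u)) => [|i _]; last by rewrite subrK.
  by rewrite sumr_const card_ord normrMn mulr_natl.
apply: (le_trans (ler_normD _ _)); apply: lerD.
  apply: (le_trans (ler_norm_sum _ _ _)).
  apply: (@le_trans _ _ (\sum_(i < n) (B * M))); last first.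
    by rewrite sumr_const card_ord mulr_natl.
  apply: ler_sum => i _; have /andP[l1 lb] := lB i (ltn_ord i).
  by apply: (le_trans (norm_sub_slice l1)); rewrite ler_wpM2r.
apply: (@norm_disjoint_sum (fun i => slice (l i)) n) => // [i|i j /andP[ij jn]].
  by apply: norm_vle.
have /andP[_ lb] := lB j jn.
by apply: slice_disjoint => //; [lra|exact: lN].
Qed.

End Slices.

(** For each [l] slightly above [1], the supremum [x \/ y] is, up to a thin slice
    along [x = l y], bounded by the supremum of two disjoint elements below [x]
    and [l y]. The slices for sufficiently separated [l] are disjoint, so that
    their average is small in norm. *)
Lemma norm_vsup_max x y : vle 0 x -> vle 0 y ->
  `|vsup x y| <= Num.max `|x| `|y|.
Proof.
move=> x0 y0; set M := Num.max _ _; set v := `|vsup x y|.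
have M0 : 0 <= M by rewrite le_max normr_ge0.
have H n : n.+1%:R * v <= n.+2%:R * M + v.
  set k : R := n.+1%:R; have k1 : 1 <= k by rewrite ler1n.
  have k0 : k != 0 by rewrite gt_eqF//; lra.
  have -> : n.+2%:R * M = k * ((1 + k^-1) * M).
    by rewrite mulrA mulrDr mulr1 divff// natr1.
  have kk1 : 1 <= k * k by rewrite mulr_ege1.
  have kk0 : 0 < k * k by lra.
  have N8 : 8 <= 8 * (k * k) by lra.
  (* The [k] values of [l] have gaps [1 / k^2] and lie in [1, 1 + 1 / k]. *)
  apply: (norm_vsup_slices x0 y0 N8 (l := fun i => 1 + i%:R / (k * k))).
  - move=> i ik; rewrite lerDl divr_ge0//=; last lra.
    rewrite lerD2l ler_pdivrMr// mulrA mulVf// mul1r ler_nat.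
    exact: ltnW.
  - by rewrite (_ : 2 = 1 + 1)// lerD2l invf_le1//; lra.
  - move=> i j ij; rewrite opprD addrACA subrr add0r -mulrBl mulrCA mulfK.
      by rewrite -natrB 1?ltnW// -natrM ler_nat -[X in (X <= _)%N]mul1n leq_mul2r
        subn_gt0 ij orbT.
    by rewrite gt_eqF.
rewrite leNgt; apply/negP => Mv.
have d0 : 0 < v - M by lra.
have p0 : 0 <= (M + v) / (v - M) by rewrite divr_ge0//; lra.
have := archi_boundP p0; rewrite ltr_pdivrMr//; move: (Num.bound _) => n h.
by have := H n; rewrite -!natr1; lra.
Qed.

End DisjointlyMaximalNorm.

(** * The lattice form of the Stone-Weierstrass theorem *)

Section LatticeStoneWeierstrass.
Variable R : realType.

(** Compactness in the form that suits a lattice of functions: a directed family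
    of sets whose interiors cover [K] has a member that contains [K]. *)
Lemma compact_directed (I : Type) (T : topologicalType) (K : set T)
    (D : set I) (W : I -> set T) :
  compact K -> D !=set0 ->
  (forall i j, D i -> D j -> exists k, [/\ D k, W i `<=` W k & W j `<=` W k]) ->
  (forall x, K x -> exists2 i, D i & nbhs x (W i)) ->
  exists2 i, D i & K `<=` W i.
Proof.
move=> /compact_near_coveringP cK [i0 Di0] Ddir Dcov.
pose above i := [set k | D k /\ W i `<=` W k].
pose F := filter_from D above.
have FF : Filter F.
  apply: filter_from_filter; first by exists i0.
  move=> i j Di Dj; have [k [Dk ik jk]] := Ddir i j Di Dj.
  by exists k => // l [Dl kl]; split; split=> //; exact: subset_trans kl.
have [x Kx|i Di iK] := cK I F W FF; last first.
  by exists i => //; apply: (iK i); split.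
have [i Di xi] := Dcov x Kx.
exists (W i, above i) => //=; first by split=> //; exists i.
by move=> [y j] /= [iy [_ ij]]; exact: ij.
Qed.

Section Approximation.
Variables (U : vectorLatticeType R) (T : topologicalType) (ev : U -> T -> R).
Variables (K : set T) (L : set U) (f : U).
Hypothesis cK : compact K.
Hypothesis slL : sublattice L.
Hypothesis evS : forall t u v, K t -> L u -> L v ->
  ev (vsup u v) t = Num.max (ev u t) (ev v t).
Hypothesis evI : forall t u v, K t -> L u -> L v ->
  ev (vinf u v) t = Num.min (ev u t) (ev v t).
Hypothesis evc : forall u, L u -> continuous (ev u).
Hypothesis evfc : continuous (ev f).
Hypothesis two_points : forall s t, K s -> K t ->
  exists u, [/\ L u, ev u s = ev f s & ev u t = ev f t].

(** Interpolation at [s] and at a variable second point, a finite infimum and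
    then a finite supremum. *)
Lemma lattice_stone_weierstrass e : 0 < e ->
  exists2 u, L u & forall t, K t -> `|ev f t - ev u t| <= e.
Proof.
move=> e0; have [L0 _ LS LI] := slL.
pose lo u := [set t | K t -> ev u t < ev f t + e].
pose hi u := [set t | K t -> ev f t - e < ev u t].
have evB u : L u -> continuous (fun t => ev u t - ev f t).
  by move=> Lu t; apply: continuousB; [exact: evc|exact: evfc].
have nlo u t : L u -> ev u t = ev f t -> nbhs t (lo u).
  move=> Lu ut; have c := evB u Lu t.
  have lt0 : ev u t - ev f t < e by rewrite ut subrr.
  apply: filterS (cvgr_lt _ c _ lt0) => x /= xe _; lra.
have nhi u t : L u -> ev u t = ev f t -> nbhs t (hi u).
  move=> Lu ut; have c := evB u Lu t.
  have lt0 : - e < ev u t - ev f t by rewrite ut subrr; lra.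
  apply: filterS (cvgr_gt _ c _ lt0) => x /= xe _; lra.
have [K0|/set0P[s0 Ks0]] := eqVneq K set0; first by exists 0 => // t; rewrite K0.
have step s : K s -> exists u, [/\ L u, K `<=` lo u & nbhs s (hi u)].
  move=> Ks; have [u0 [Lu0 u0s _]] := two_points Ks Ks.
  have [|||u [Lu us] Ku] := @compact_directed U T K
      [set u | L u /\ ev u s = ev f s] lo cK.
  - by exists u0.
  - move=> u v [Lu us] [Lv vs]; exists (vinf u v); split.
    + by split; [exact: LI|rewrite evI// us vs minxx].
    + by move=> t lt Kt; rewrite evI// gt_min lt.
    + by move=> t lt Kt; rewrite evI// gt_min lt// orbT.
  - move=> t Kt; have [u [Lu us ut]] := two_points Ks Kt.
    by exists u => //; exact: nlo.
  by exists u; split=> //; exact: nhi.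
have [|||u [Lu uK] Ku] := @compact_directed U T K
    [set u | L u /\ K `<=` lo u] hi cK.
- by have [u [Lu uK _]] := step _ Ks0; exists u.
- move=> u v [Lu us] [Lv vs]; exists (vsup u v); split.
  + split; first exact: LS.
    by move=> t Kt _; rewrite evS// gt_max us ?vs.
  + by move=> t lt Kt; rewrite evS// lt_max lt.
  + by move=> t lt Kt; rewrite evS// lt_max lt// orbT.
- by move=> s /step[u [Lu uK us]]; exists u.
exists u => // t Kt; have := uK t Kt Kt; have := Ku t Kt Kt.
by rewrite ler_norml => h1 h2; apply/andP; split; lra.
Qed.

End Approximation.

(** The values of two lattice homomorphisms on a sublattice fill the plane unless
    one of the two is a nonnegative multiple of the other; a negative multiple
    of a nonzero homomorphism does not preserve positive parts. *)
Lemma sublattice_two_points (U : vectorLatticeType R) (L : set U)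
    (sigma tau : U -> R^o) (a b : R) :
  sublattice L -> lattice_hom_on L sigma -> lattice_hom_on L tau ->
  (forall l : R, 0 <= l -> (forall u, L u -> sigma u = l * tau u) -> a = l * b) ->
  ((forall u, L u -> tau u = 0) -> b = 0) ->
  exists u, [/\ L u, sigma u = a & tau u = b].
Proof.
move=> slL hs ht hab hb.
have L0 := sublattice0 slL; have s0 := hom0 slL hs; have t0 := hom0 slL ht.
have LZ (c : R) u : L u -> L (c *: u) by exact: sublatticeZ.
have sZ (c : R) u : L u -> sigma (c *: u) = c * sigma u by exact: homZ.
have tZ (c : R) u : L u -> tau (c *: u) = c * tau u by exact: homZ.
have [tn|] := pselect (exists2 x, L x & tau x != 0); last first.
  move=> /forall2NP tz; have {}tz u : L u -> tau u = 0.
    by move=> Lu; case: (tz u) => // /negP; rewrite negbK => /eqP.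
  rewrite hb//; have [[x Lx sx]|] := pselect (exists2 x, L x & sigma x != 0).
    exists ((a / sigma x) *: x).
    by split; [exact: LZ|rewrite sZ// divfK|rewrite tZ// tz// mulr0].
  move=> /forall2NP sz; have {}sz u : L u -> sigma u = 0.
    by move=> Lu; case: (sz u) => // /negP; rewrite negbK => /eqP.
  exists 0; rewrite s0 t0 (hab 0) ?mul0r// => u Lu.
  by rewrite sz// mul0r.
case: tn => x Lx tx; pose l : R := sigma x / tau x.
have [sl_eq|] := pselect (forall u, L u -> sigma u = l * tau u); last first.
  move=> /existsNP[y /not_implyP[Ly /eqP sy]].
  pose z := (- (tau y / tau x)) *: x + y.
  have Lz : L z by exact: sublattice_lin.
  have tz : tau z = 0.
    by rewrite (hom_lin ht)// [_ *: _ : R]mulNr divfK// addNr.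
  have sz : sigma z != 0.
    rewrite (hom_lin hs)// addrC [_ *: _ : R]mulNr subr_eq0; apply: contra_neq sy => ->.
    by rewrite /l [LHS]mulrC mulrA mulrAC.
  pose v := (b / tau x) *: x.
  exists (((a - sigma v) / sigma z) *: z + v).
  have Lv : L v by exact: LZ.
  split; first exact: sublattice_lin.
    by rewrite (hom_lin hs)// [_ *: _ : R]divfK// subrK.
  by rewrite (hom_lin ht)// tz scaler0 add0r tZ// divfK.
have [l0|l0] := leP 0 l.
  exists ((b / tau x) *: x); split; first exact: LZ.
    by rewrite (hab l)// sl_eq ?tZ ?divfK//; exact: LZ.
  by rewrite tZ// divfK.
have := sl_eq _ (sublattice_vsup slL Lx L0).
rewrite (hom_vsup hs)// (hom_vsup ht)// s0 t0 sl_eq//.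
change (Num.max (l * (tau x : R)) 0 = l * Num.max (tau x : R) 0 -> exists u,
  [/\ L u, sigma u = a & tau u = b]).
case: (ltgtP (tau x : R) 0) tx => // t00 _.
  have lt : 0 < l * (tau x : R) by rewrite nmulr_rgt0.
  by rewrite max_l ?ltW// mulr0 => lt0; rewrite lt0 ltxx in lt.
have lt : l * (tau x : R) < 0 by rewrite nmulr_rlt0.
by rewrite max_r ?ltW// => lt0; rewrite -lt0 ltxx in lt.
Qed.

End LatticeStoneWeierstrass.

(** * Positively homogeneous functions and their calculus on the real line *)

Section ContinuousSublattice.
Variable R : realType.

Lemma sublattice_Cfun (T : topologicalType) : sublattice (@Cfun R T).
Proof.
split.
- by move=> t; exact: cst_continuous.
- move=> a u v cu cv t; apply: continuousD; last exact: cv.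
  by apply: (@continuousM _ _ (cst a) u); [exact: cst_continuous|exact: cu].
- by move=> u v cu cv t; apply: continuous_max; [exact: cu|exact: cv].
- by move=> u v cu cv t; apply: continuous_min; [exact: cu|exact: cv].
Qed.

Variable m : nat.
Implicit Types (h g : 'rV[R]_m -> R) (t : 'rV[R]_m).

Lemma sublattice_Hm : sublattice (@Hm R m).
Proof.
have sC := sublattice_Cfun 'rV[R]_m.
split.
- by split=> [|a t a0]; [exact: sublattice0 sC|rewrite mulr0].
- move=> a u v [cu hu] [cv hv]; split=> [|b t b0].
    exact: sublattice_lin sC _ _ _ cu cv.
  rewrite -[LHS]/(a * u (b *: t) + v (b *: t)) hu// hv//.
  by rewrite -[RHS]/(b * (a * u t + v t)); ring.
- move=> u v [cu hu] [cv hv]; split=> [|b t b0].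
    exact: sublattice_vsup sC _ _ cu cv.
  rewrite -[LHS]/(Num.max (u (b *: t)) (v (b *: t))) hu// hv//.
  by rewrite -maxr_pMr.
- move=> u v [cu hu] [cv hv]; split=> [|b t b0].
    exact: sublattice_vinf sC _ _ cu cv.
  rewrite -[LHS]/(Num.min (u (b *: t)) (v (b *: t))) hu// hv//.
  by rewrite -minr_pMr.
Qed.

Lemma Hm_coordf k : Hm (@coordf R m k).
Proof.
by split=> [|a t a0]; [exact: coord_continuous|rewrite /coordf mxE].
Qed.

Definition l1norm : 'rV[R]_m -> R := \sum_k vabs (@coordf R m k).

Lemma l1normE t : l1norm t = \sum_k `|t ord0 k|.
Proof.
rewrite /l1norm fct_sumE; apply: eq_bigr => k _.
by rewrite -vabs_real.
Qed.

Lemma Hm_l1norm : Hm l1norm.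
Proof.
apply: (sublattice_sum sublattice_Hm) => k.
by apply: (sublattice_vabs sublattice_Hm); exact: Hm_coordf.
Qed.

Lemma coord_le_l1norm t k : `|t ord0 k| <= l1norm t.
Proof. by rewrite l1normE (bigD1 k)//= lerDl sumr_ge0. Qed.

Let sphere : set 'rV[R]_m := [set t | l1norm t = 1].

Let compact_sphere : compact sphere.
Proof.
have cl : closed sphere.
  rewrite (_ : sphere = l1norm @^-1` [set 1]) //; apply: preimage_closed.
    by move=> t _; exact: Hm_l1norm.1.
  exact: closed_eq.
have cb := @rV_compact R m (fun=> `[-1, 1]%classic)
  (fun=> @segment_compact R (-1) 1).
apply: (subclosed_compact cl cb).
move=> t /= t1 k; rewrite in_itv/= -ler_norml -t1; exact: coord_le_l1norm.
Qed.

(** On the unit sphere of the [l1] norm this is the lattice form of the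
    Stone-Weierstrass theorem: if the coordinates of [s] are [l >= 0] times those
    of [t], homogeneity forces [h s = l * h t]. *)
Lemma Hm_dense (L : set ('rV[R]_m -> R)) h e :
  L `<=` @Hm R m -> sublattice L -> (forall k, L (@coordf R m k)) ->
  Hm h -> 0 < e ->
  exists2 g, L g & forall t, `|h t - g t| <= e * l1norm t.
Proof.
move=> LH slL Lc [ch hh] e0.
have [|||||g Lg gh] := @lattice_stone_weierstrass R _ _
   (fun u : 'rV[R]_m -> R => u) sphere L h compact_sphere slL _ _ _ _ _ e e0 => //.
- by move=> u /LH[].
- move=> s t _ _.
  have [||||u [Lu us ut]] := @sublattice_two_points R _ L (fun u => u s)
    (fun u => u t) (h s) (h t) slL; last by exists u.
  + by split.
  + by split.
  + move=> l l0 sl; rewrite (_ : s = l *: t) ?hh//.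
    by apply/rowP => k; rewrite mxE; exact: sl (Lc k).
  + move=> t0; rewrite (_ : t = 0 *: t) ?hh ?mul0r//.
    by apply/rowP => k; rewrite mxE mul0r; exact: t0 (Lc k).
exists g => // t; have [cg hg] := LH _ Lg.
have N0 : 0 <= l1norm t by rewrite l1normE sumr_ge0.
have [Nt0|Nt] := eqVneq (l1norm t) 0.
  have -> : t = 0 *: t.
    apply/rowP => k; rewrite mxE mul0r; apply/eqP; rewrite -normr_eq0.
    by have := coord_le_l1norm t k; rewrite Nt0 => H; apply/eqP/le_anti; rewrite H/=.
  by rewrite hh// hg// Hm_l1norm.2// !mul0r subrr normr0 mulr0.
have i0 : 0 <= (l1norm t)^-1 by rewrite invr_ge0.
have := gh ((l1norm t)^-1 *: t); rewrite hh// hg// -mulrBr normrM ger0_norm//.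
rewrite ler_pdivrMl ?lt_def ?Nt// mulrC; apply.
by rewrite /sphere/= Hm_l1norm.2// mulVf.
Qed.

(** [L] below is the sublattice on which [Phi] is the evaluation; [Phi] is
    monotone, so that [L] is closed for the approximation of the density lemma. *)
Lemma Hm_hom_real (Phi : ('rV[R]_m -> R) -> R^o) t :
  lattice_hom_on (@Hm R m) Phi -> (forall k, Phi (coordf k) = t ord0 k) ->
  forall h, Hm h -> Phi h = h t.
Proof.
move=> hP Pc h Hh; have sH := sublattice_Hm.
pose L := [set g | Hm g /\ Phi g = g t].
have slL : sublattice L.
  split.
  - by split; [exact: sublattice0 sH|rewrite (hom0 sH hP)].
  - move=> a u v [Hu Pu] [Hv Pv]; split; first exact: sublattice_lin.
    by rewrite (hom_lin hP)// Pu Pv.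
  - move=> u v [Hu Pu] [Hv Pv]; split; first exact: sublattice_vsup.
    by rewrite (hom_vsup hP)// Pu Pv.
  - move=> u v [Hu Pu] [Hv Pv]; split; first exact: sublattice_vinf.
    by rewrite (hom_vinf hP)// Pu Pv.
have Lc k : L (coordf k) by split; [exact: Hm_coordf|exact: Pc].
have [_ PN] : L l1norm.
  by apply: (sublattice_sum slL) => k; exact: sublattice_vabs.
apply/eqP; rewrite -subr_eq0 -normr_eq0; apply/eqP/le_anti.
rewrite normr_ge0 andbT; apply/ler_addgt0Pl => e e0; rewrite addr0.
have N0 : 0 <= l1norm t by rewrite l1normE sumr_ge0.
pose d := e / (2 * (l1norm t + 1)).
have d0 : 0 < d by rewrite divr_gt0//; lra.
have [g [Hg Pg] gh] := @Hm_dense L h d (fun g => @proj1 _ _) slL Lc Hh d0.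
have HdN : Hm (d *: l1norm) by apply: sublatticeZ => //; exact: Hm_l1norm.
have PdN : Phi (d *: l1norm) = d * l1norm t.
  by rewrite (homZ sH hP) ?PN//; exact: Hm_l1norm.
have h1 : (Phi h : R) <= Phi (d *: l1norm + g).
  apply: (hom_vle hP) => //; first exact: sublatticeD.
  move=> s; rewrite -[(_ + _) s]/(d * l1norm s + g s).
  by have := gh s; rewrite ler_norml => /andP[]; lra.
have h2 : Phi g <= Phi (d *: l1norm + h) :> R.
  apply: (hom_vle hP) => //; first exact: sublatticeD.
  move=> s; rewrite -[(_ + _) s]/(d * l1norm s + h s).
  by have := gh s; rewrite ler_norml => /andP[]; lra.
move: h1 h2; rewrite !(homD hP)// PdN Pg => h1 h2.
have hd : d * (2 * (l1norm t + 1)) = e by rewrite divfK// gt_eqF//; lra.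
have := gh t; rewrite !ler_norml => /andP[h3 h4].
by apply/andP; split; lra.
Qed.

End ContinuousSublattice.

Section RealFunctionCalculus.
Variable R : realType.

(** Evaluation at the point [x] is one of the homomorphisms among which [fcalc]
    chooses, and they all agree on [Hm]. *)
Lemma fcalc_real m (x : 'I_m -> R^o) h : Hm h ->
  fcalc x h = h (\row_k (x k : R)).
Proof.
move=> Hh; have [|hP Pc] := @getPex _ [set Phi : ('rV[R]_m -> R) -> R^o |
    lattice_hom_on (@Hm R m) Phi /\ forall k, Phi (coordf k) = x k].
  exists (fun h => h (\row_k (x k : R))); split; first by split.
  by move=> k; rewrite /coordf mxE.
by apply: (Hm_hom_real hP) => // k; rewrite mxE; exact: Pc.
Qed.

Lemma Dconvex_real (D : convexity_condition R) : Dconvex D R^o.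
Proof.
move=> m g Dg x x0 _; have [_ Hg gm] := cc_fun_sub Dg.
rewrite fcalc_real//; have -> : \row_k `|x k| = \row_k (x k : R) :> 'rV[R]_m.
  by apply/rowP => k; rewrite !mxE ger0_norm//; exact: x0.
have g0 : 0 <= g (\row_k (x k : R)).
  have <- : g (0 *: (0 : 'rV[R]_m)) = 0 by rewrite Hg.2// mul0r.
  by apply: gm => k; rewrite !mxE mul0r lexx; exact: x0.
by rewrite ger0_norm// ler_peMl//; exact: cc_const_ge1.
Qed.

End RealFunctionCalculus.

(** * The function calculus of a Banach lattice *)

Section Completeness.
Variable R : realType.

Lemma natSinv_lt (e : R) : 0 < e -> exists n, n.+1%:R^-1 < e.
Proof.
move=> e0; have p0 : 0 <= e^-1 by rewrite invr_ge0 ltW.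
exists (Num.bound e^-1); have := archi_boundP p0; move: (Num.bound _) => n h.
rewrite invf_plt ?posrE//; apply: (lt_trans h); rewrite ltr_nat//.
Qed.

Lemma natSinv_cauchy_cvg (V : completeNormedModType R) (u : nat -> V) (c : R) :
  (forall n k, `|u n - u k| <= c * (n.+1%:R^-1 + k.+1%:R^-1)) ->
  exists l, forall n, `|l - u n| <= c * n.+1%:R^-1.
Proof.
move=> H; have c0 : 0 <= c.
  have := H 0%N 0%N; rewrite subrr normr0 invr1; lra.
have small (e : R) : 0 < e -> \forall k \near \oo, c * k.+1%:R^-1 < e.
  move=> e0; have [r r0 rE] : exists2 r, 0 < r & r * (c + 1) = e.
    have c1 : 0 < c + 1 by lra.
    by exists (e / (c + 1)); rewrite ?divr_gt0// divfK// gt_eqF.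
  have [N HN] := natSinv_lt r0; exists N => // k /= Nk.
  have kr : k.+1%:R^-1 <= r.
    by apply: (le_trans _ (ltW HN)); rewrite lef_pV2 ?posrE// ler_nat.
  by apply: (le_lt_trans (ler_wpM2l c0 kr)); rewrite -rE; lra.
have cu : cvgn u.
  apply/cauchy_cvgP/cauchy_ballP => e e0.
  have e2 : 0 < e / 2 by lra.
  have [N _ HN] := small _ e2.
  exists (u @` [set k | (N <= k)%N], u @` [set k | (N <= k)%N]) => /=.
    by split; exists N => // k /= Nk; exists k.
  move=> [_ _] /= [[n /= /HN hn <-] [k /= /HN hk <-]]; rewrite -ball_normE/=.
  by apply: (le_lt_trans (H n k)); move: hn hk => /=; rewrite mulrDr;
    move: (c * _) (c * _) => p q; lra.
exists (limn u) => n; apply/ler_addgt0Pl => e e0.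
have e2 : 0 < e / 2 by lra.
have near1 : \forall k \near \oo, `|limn u - u k| < e / 2.
  by move/cvgrPdist_lt : cu; apply.
have [k [k1 k2]] := filter_ex (filterI near1 (small _ e2)).
have := H k n; have := ler_distD (u k) (limn u) (u n); move: k1 k2 => /=.
by rewrite mulrDr; move: (c * _) (c * _) => p q; lra.
Qed.

End Completeness.

Section FunctionCalculus.
Variables (R : realType) (X : banachLatticeType R).

(** An ideal is complete for the gauge of its unit, hence closed under limits
    that are uniform over its lattice homomorphisms. *)
Lemma ideal_complete (e : X) (Psi : (X -> R^o) -> R) : vle 0 e ->
  (forall d : R, 0 < d -> exists2 y, ideal e y &
     forall tau : X -> R^o, lattice_hom_on (ideal e) tau ->
       `|Psi tau - tau y| <= d * tau e) ->
  exists2 y, ideal e y &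
    forall tau : X -> R^o, lattice_hom_on (ideal e) tau -> tau y = Psi tau.
Proof.
move=> e0 H; have sI := sublattice_ideal e0; have Ie := ideal_norm e0.
pose eps n : R := n.+1%:R^-1.
have eps0 n : 0 < eps n by rewrite invr_gt0.
have /choice[u Hu] : forall n, exists y, ideal e y /\
    forall tau : X -> R^o, lattice_hom_on (ideal e) tau ->
       `|Psi tau - tau y| <= eps n * tau e.
  by move=> n; have [y Iy Hy] := H _ (eps0 n); exists y.
have Iu n : ideal e (u n) by case: (Hu n).
have te0 (tau : X -> R^o) : lattice_hom_on (ideal e) tau -> 0 <= tau e :> R.
  move=> ht; rewrite -[X in X <= _](hom0 sI ht).
  by apply: (hom_vle ht) => //; exact: sublattice0 sI.
have uu n k : vle (u n - u k) ((eps n + eps k) *: e).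
  apply: (ideal_hom_vle e0).
  - by apply: sublatticeD => //; exact: sublatticeN.
  - exact: sublatticeZ.
  move=> tau ht; rewrite (homD ht)//; last exact: sublatticeN.
  rewrite (homN sI ht)// (homZ sI ht)//.
  have := (Hu n).2 tau ht; have := (Hu k).2 tau ht.
  rewrite !ler_norml => /andP[h1 h2] /andP[h3 h4].
  rewrite -[leRHS]/((eps n + eps k) * tau e) mulrDl.
  rewrite -[leLHS]/((tau (u n) : R) - tau (u k)); lra.
have [y yu] : exists y, forall n, `|y - u n| <= `|e| * eps n.
  apply: natSinv_cauchy_cvg => n k; rewrite mulrC.
  have -> : (eps n + eps k) * `|e| = `|(eps n + eps k) *: e|.
    by rewrite normrZ ger0_norm// addr_ge0// ltW.
  apply: norm_vle_abs; first exact: uu.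
  by rewrite opprB addrC [eps n + _]addrC; have := uu k n; rewrite addrC.
have vle_lim (z w : X) (v : nat -> X) : (forall k, `|z - v k| <= `|e| * eps k) ->
    (forall k, vle (v k) (w + eps k *: e)) -> vle z w.
  move=> zv vw; apply/vle_subr/vle0_closed => d d0.
  have [r r0 rE] : exists2 r, 0 < r & r * (2 * (`|e| + 1)) = d.
    have c1 : 0 < 2 * (`|e| + 1) by rewrite mulr_gt0// ltr_wpDl.
    by exists (d / (2 * (`|e| + 1))); rewrite ?divr_gt0// divfK// gt_eqF.
  have [k kr] := natSinv_lt r0; exists (w + eps k *: e - v k).
    exact: (vle_subr _ _).1.
  rewrite [X in `|X|](_ : _ = - (eps k *: e) - (z - v k)); last first.
    rewrite opprD opprK addrACA [- (w + _)]opprD [w + (_ - _)]addrA subrr add0r.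
    by rewrite opprB [- z + _]addrC.
  apply: (le_trans (ler_normB _ _)); rewrite normrN normrZ ger0_norm ?ltW//.
  have := ler_wpM2l (normr_ge0 e) (ltW kr); have := zv k.
  by rewrite -rE -/(eps k) [eps k * _]mulrC; move: (`|e| * eps k) => q; lra.
have yu_le n : vle (y - u n) (eps n *: e) /\ vle (- (y - u n)) (eps n *: e).
  split; [apply: (vle_lim _ _ (fun k => u k - u n))|
          apply: (vle_lim _ _ (fun k => u n - u k))] => k.
  - by rewrite opprB addrA subrK; exact: yu.
  - by rewrite -scalerDl [eps n + _]addrC; exact: uu.
  - by rewrite -opprD addrA subrK normrN; exact: yu.
  - by rewrite -scalerDl; exact: uu.
have Iy : ideal e y.
  rewrite -[y](subrK (u 0%N)); apply: sublatticeD => //.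
  have [h1 h2] := yu_le 0%N; apply: ideal_vle h1 h2.
  exact: sublatticeZ.
exists y => // tau ht; apply/eqP; rewrite -subr_eq0 -normr_eq0; apply/eqP/le_anti.
rewrite normr_ge0 andbT; apply/ler_addgt0Pl => d d0; rewrite addr0.
have t0 := te0 tau ht.
have [r r0 rE] : exists2 r, 0 < r & r * (2 * (tau e + 1)) = d.
  have c1 : 0 < 2 * ((tau e : R) + 1) by rewrite mulr_gt0// ltr_wpDl.
  by exists (d / (2 * (tau e + 1))); rewrite ?divr_gt0// divfK// gt_eqF.
have [n nr] := natSinv_lt r0.
have It : ideal e (eps n *: e) by exact: sublatticeZ.
have IyN : ideal e (y - u n) by apply: sublatticeD => //; exact: sublatticeN.
have [/(hom_vle ht IyN It) h1 /(hom_vle ht (sublatticeN sI IyN) It) h2] := yu_le n.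
move: h1 h2; rewrite (homN sI ht)// (homZ sI ht)// (homD ht)//; last exact: sublatticeN.
rewrite (homN sI ht)//.
have := (Hu n).2 tau ht; have := ler_wpM2r t0 (ltW nr); rewrite -/(eps n).
move: (tau e) (tau y) (tau (u n)) t0 rE => te ty tu t0 rE.
rewrite !ler_norml => h3 /andP[h4 h5].
rewrite -[vle (ty - tu) _]/(is_true (ty - tu <= eps n * te :> R)) => h1.
rewrite -[vle (- _) _]/(is_true (- (ty - tu) <= eps n * te :> R)) => h2.
move: (eps n * te) h1 h2 h3 h4 h5 => q *; apply/andP; split; lra.
Qed.

(** The elements [y] of the ideal of [e = sum_k |x_k|] that take the value
    [h(tau x_1, ..., tau x_m)] at every [tau] are unique, and those [h] that
    admit one form a sublattice containing the coordinates; it is everything by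
    density and completeness. *)
Lemma fcalc_hom m (x : 'I_m -> X) :
  lattice_hom_on (@Hm R m) (fcalc x) /\ forall k, fcalc x (coordf k) = x k.
Proof.
suff : exists Phi : ('rV[R]_m -> R) -> X,
    lattice_hom_on (@Hm R m) Phi /\ forall k, Phi (coordf k) = x k.
  exact: getPex.
pose e : X := \sum_k vabs (x k); pose I := ideal e.
have e0 : vle 0 e.
  by rewrite /e; elim/big_ind: _ => *; [exact: vle_refl|exact: vle0D|exact: vabs_ge0].
have sI : sublattice I := sublattice_ideal e0.
have Ix k : I (x k).
  have xe := vle_sum k (fun j => vabs_ge0 (x j)); have [h1 h2] := vabs_ge (x k).
  by apply: (ideal_vle (ideal_norm e0)); apply: vle_trans xe.
pose rho (tau : X -> R^o) : 'rV[R]_m := \row_k (tau (x k) : R).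
pose value h y := I y /\
  forall tau : X -> R^o, lattice_hom_on I tau -> tau y = h (rho tau).
have te (tau : X -> R^o) : lattice_hom_on I tau -> tau e = l1norm (rho tau) :> R.
  move=> ht; rewrite (hom_sum sI ht) => [|k]; last exact: sublattice_vabs.
  rewrite l1normE; apply: eq_bigr => k _.
  by rewrite (hom_vabs sI ht)// mxE vabs_real.
have uniq_value h y z : value h y -> value h z -> y = z.
  move=> [Iy hy] [Iz hz]; apply: (ideal_hom_eq e0) => // tau ht.
  by rewrite hy ?hz.
have value_lin a u v y z : value u y -> value v z ->
    value (a *: u + v) (a *: y + z).
  move=> [Iy hy] [Iz hz]; split; first exact: sublattice_lin.
  by move=> tau ht; rewrite (hom_lin ht)// hy ?hz.
have value_sup u v y z : value u y -> value v z -> value (vsup u v) (vsup y z).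
  move=> [Iy hy] [Iz hz]; split; first exact: sublattice_vsup.
  by move=> tau ht; rewrite (hom_vsup ht)// hy ?hz.
have value_inf u v y z : value u y -> value v z -> value (vinf u v) (vinf y z).
  move=> [Iy hy] [Iz hz]; split; first exact: sublattice_vinf.
  by move=> tau ht; rewrite (hom_vinf ht)// hy ?hz.
have value_coord k : value (coordf k) (x k).
  by split=> // tau ht; rewrite /coordf mxE.
pose L := [set h | Hm h /\ exists y, value h y].
have sH := @sublattice_Hm R m.
have sL : sublattice L.
  split.
  - split; first exact: sublattice0 sH.
    exists 0; split; first exact: sublattice0 sI.
    by move=> tau ht; rewrite (hom0 sI ht).
  - move=> a u v [Hu [y uy]] [Hv [z vz]]; split; first exact: sublattice_lin.
    by exists (a *: y + z); exact: value_lin.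
  - move=> u v [Hu [y uy]] [Hv [z vz]]; split; first exact: sublattice_vsup.
    by exists (vsup y z); exact: value_sup.
  - move=> u v [Hu [y uy]] [Hv [z vz]]; split; first exact: sublattice_vinf.
    by exists (vinf y z); exact: value_inf.
have Lc k : L (coordf k) by split; [exact: Hm_coordf|exists (x k)].
have ex_value h : Hm h -> exists y, value h y.
  move=> Hh; have [|y Iy hy] := @ideal_complete e (fun tau => h (rho tau)) e0.
    move=> d d0.
    have [g [Hg [y [Iy gy]]] gh] := Hm_dense (fun g => @proj1 _ _) sL Lc Hh d0.
    by exists y => // tau ht; rewrite gy// te.
  by exists y.
have /choice[Phi Phi_value] : forall h, exists y, Hm h -> value h y.
  move=> h; have [/ex_value[y hy]|nH] := pselect (Hm h); first by exists y.
  by exists 0.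
exists Phi; split.
  split.
  - move=> a u v Hu Hv; apply: uniq_value (Phi_value _ _) _.
      exact: sublattice_lin.
    by apply: value_lin; exact: Phi_value.
  - move=> u v Hu Hv; apply: uniq_value (Phi_value _ _) _.
      exact: sublattice_vsup.
    by apply: value_sup; exact: Phi_value.
  - move=> u v Hu Hv; apply: uniq_value (Phi_value _ _) _.
      exact: sublattice_vinf.
    by apply: value_inf; exact: Phi_value.
move=> k; apply: uniq_value (Phi_value _ _) (value_coord k).
exact: Hm_coordf.
Qed.

Lemma fcalc_linf2 (x : 'I_2 -> X) :
  fcalc x (@linf2 R) = vsup (vabs (x ord0)) (vabs (x ord_max)).
Proof.
have [hF Fc] := fcalc_hom x; have sH := @sublattice_Hm R 2.
have -> : @linf2 R = vsup (vabs (coordf ord0)) (vabs (coordf ord_max)).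
  by apply/funext => t; rewrite /linf2 -!vabs_real.
rewrite (hom_vsup hF); try by apply: sublattice_vabs => //; exact: Hm_coordf.
by rewrite !(hom_vabs sH hF) ?Fc//; exact: Hm_coordf.
Qed.

End FunctionCalculus.

(** * Real lattice homomorphisms on AM-spaces; operator norms; uniform closure *)

Section RealHomomorphisms.
Variables (R : realType) (X : banachLatticeType R).
Implicit Types (x y u : X).

(** The condition for the maximum function gives the inequality at least for
    disjoint elements, which suffices. *)
Lemma AM_norm_vsup (D : convexity_condition R) :
  AM_convexity D -> Dconvex D X ->
  forall x y, vle 0 x -> vle 0 y -> `|vsup x y| <= Num.max `|x| `|y|.
Proof.
move=> [Dl D1] DX; apply: norm_vsup_max => x y x0 y0 xy.
pose z (k : 'I_2) := if k == ord0 then x else y.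
have := DX 2%N _ Dl z; rewrite fcalc_linf2 D1 mul1r /linf2 !mxE !normr_id /z/=.
rewrite !vabs_id//; apply=> [k|_ j k jk]; first by case: ifP.
rewrite /disjoint_vl; case: ifP => j0; case: ifP => k0; rewrite !vabs_id//.
- by move: jk; rewrite (eqP j0) (eqP k0) eqxx.
- by rewrite vinf_vsup vsupC -vinf_vsup.
- move: jk j0 k0; case: j => [[|[|]]]// ?; case: k => [[|[|]]]// ?.
Qed.

(** When the norm of a supremum of positive elements is the maximum of the
    norms, [x |-> |x^+|] is a gauge, and below it lie lattice homomorphisms that
    attain the norm. *)
Lemma norming_hom u :
  (forall x y, vle 0 x -> vle 0 y -> `|vsup x y| <= Num.max `|x| `|y|) ->
  exists tau : X -> R^o,
    [/\ lattice_hom tau, forall x, `|tau x : R| <= `|x| & `|tau u : R| = `|u|].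
Proof.
move=> nmax; pose p x := `|vsup x 0|.
have p0 x : vle 0 (vsup x 0) by exact: (vsup_ub _ _).2.
have gp : max_gauge [set: X] p.
  split.
  - move=> x y _ _; apply: le_trans (ler_normD _ _).
    by apply: norm_vle (p0 _) (vsup0D _ _).
  - move=> a x a0 _; rewrite -[a in leRHS]ger0_norm// -normrZ.
    by apply: norm_vle (p0 _) (vsup0Z _ a0).
  - by move=> x y _ _; rewrite /p vsup0_vsup; exact: nmax.
have [||tau [ht tp tu]] :=
  max_gauge_lattice_hom (sublatticeT X) gp _ (_ : setT (vabs u)) => //.
  by move=> x _ /vsup_r; rewrite /p => ->; rewrite normr0.
have pn x : p x <= `|x|.
  rewrite -[leRHS]norm_vabs; apply: norm_vle => //; apply/vsup_le.
  by split; [exact: (vabs_ge x).1|exact: vabs_ge0].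
have sT := @sublatticeT R X.
exists tau; split=> // [x|].
  rewrite ler_norml; apply/andP; split; last exact: le_trans (tp x _) (pn x).
  rewrite lerNl -[leLHS](homN sT ht)//.
  by apply: le_trans (tp _ _) _ => //; rewrite -[leRHS]normrN; exact: pn.
rewrite -vabs_real -(hom_vabs sT ht)// tu /p -[RHS]norm_vabs; congr (`|_|).
by rewrite vsupC vsup_r//; exact: vabs_ge0.
Qed.

(** If [tau] is unbounded there are [y_n >= 0] with summable norms and
    [tau y_n > n]; their sum dominates every [y_n]. *)
Lemma lattice_hom_bounded (tau : X -> R^o) : lattice_hom tau ->
  exists C : R, forall x, `|tau x : R| <= C * `|x|.
Proof.
move=> ht; apply: contrapT => /forallNP unb; have sT := @sublatticeT R X.
pose a n : R := n.+1%:R^-1 - n.+2%:R^-1.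
have a0 n : 0 < a n by rewrite subr_gt0 ltf_pV2 ?posrE// ltr_nat.
have /choice[y Hy] : forall n, exists y : X,
    [/\ vle 0 y, `|y| = a n & n%:R < (tau y : R)].
  (* The norms [a n = 1 / (n + 1) - 1 / (n + 2)] have a telescoping sum. *)
  move=> n; have /existsNP[x /negP] := unb (n%:R / a n); rewrite -ltNge => xn.
  have x0 : 0 < `|x|.
    rewrite lt_def normr_ge0 andbT; apply/eqP => /normr0_eq0 x0.
    by move: xn; rewrite x0 (hom0 sT ht) !normr0 mulr0 ltxx.
  have ax : 0 < a n / `|x| by rewrite divr_gt0.
  exists ((a n / `|x|) *: vabs x); split.
  - by apply: vle_scale; [exact: ltW|exact: vabs_ge0].
  - by rewrite normrZ norm_vabs ger0_norm ?ltW// divfK// gt_eqF.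
  - rewrite (homZ sT ht)// (hom_vabs sT ht)//.
    rewrite -[X in _ < X]/(a n / `|x| * vabs (tau x : R^o)) vabs_real.
    rewrite mulrAC ltr_pdivlMr// -ltr_pdivrMl// mulrA.
    by rewrite [_^-1 * _]mulrC.
pose s n := \sum_(i < n) y i.
have s_le n k : (k <= n)%N -> `|s n - s k| <= k.+1%:R^-1 - n.+1%:R^-1.
  elim: n => [|n IH]; first by rewrite leqn0 => /eqP ->; rewrite !subrr normr0.
  rewrite leq_eqVlt => /predU1P[->|/IH h]; first by rewrite !subrr normr0.
  rewrite /s big_ord_recr/= -/(s n) addrAC; apply: (le_trans (ler_normD _ _)).
  have [_ -> _] := Hy n; rewrite /a.
  by move: h; move: (_^-1) (_^-1) (_^-1) => p q r; lra.
have [l ls] : exists l, forall n, `|l - s n| <= 1 * n.+1%:R^-1.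
  apply: natSinv_cauchy_cvg => n k; rewrite mul1r.
  have i0 j : 0 <= j.+1%:R^-1 :> R by rewrite invr_ge0.
  have [kn|/ltnW nk] := leqP k n; last rewrite distrC.
    by apply: (le_trans (s_le _ _ kn)); have := i0 n; move: (_^-1) (_^-1) => p q; lra.
  by apply: (le_trans (s_le _ _ nk)); have := i0 k; move: (_^-1) (_^-1) => p q; lra.
have yl n : vle (y n) l.
  apply/vle_subr/vle0_closed => d d0; have [N HN] := natSinv_lt d0.
  pose k := maxn N n.+1; exists (s k - y n).
    apply: (vle_subr _ _).1; have nk : (n < k)%N by rewrite leq_max leqnn orbT.
    rewrite -[n]/(nat_of_ord (Ordinal nk)).
    by apply: (vle_sum (x := fun i : 'I_k => y i)) => j; case: (Hy j).
  rewrite opprD opprK addrACA addNr addr0; apply: (le_trans (ls k)).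
  rewrite mul1r; apply: le_trans (ltW HN).
  by rewrite lef_pV2 ?posrE// ler_nat ltnS leq_max leqnn.
have tl n : n%:R <= (tau l : R).
  have [_ _ /ltW h] := Hy n; apply: (le_trans h).
  by have := hom_vle ht (I : setT (y n)) (I : setT l) (yl n).
have t0 : 0 <= (tau l : R) by exact: tl 0%N.
by have := archi_boundP t0; rewrite ltNge tl.
Qed.

Lemma lattice_hom_scale (l : R) (tau : X -> R^o) : 0 <= l -> lattice_hom tau ->
  lattice_hom (fun x => l * tau x : R^o).
Proof.
move=> l0 [tl tS tI]; split=> [a u v _ _|u v _ _|u v _ _].
- by rewrite tl// mulrDr; congr (_ + _); exact: mulrCA.
- by rewrite tS//; exact: maxr_pMr.
- by rewrite tI//; exact: minr_pMr.
Qed.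

End RealHomomorphisms.

Section OperatorNorm.
Variables (R : realType) (V W : normedModType R) (T : V -> W).

Lemma opnorm_le1 : (forall x, `|T x| <= `|x|) -> T 0 = 0 -> opnorm T <= 1.
Proof.
move=> H T0; apply: ge_sup.
  by exists `|T 0|, 0 => //=; rewrite normr0.
by move=> _ [x /= x1 <-]; exact: le_trans (H x) x1.
Qed.

Lemma le_opnorm (C : R) x : linear T -> (forall x, `|T x| <= C * `|x|) ->
  `|T x| <= opnorm T * `|x|.
Proof.
move=> lT TC; have T0 : T 0 = 0.
  have := lT 1 0 0; rewrite !scale1r addr0 => t0.
  by apply/eqP; rewrite -(inj_eq (addrI (T 0))) -t0 addr0.
have [->|x0] := eqVneq x 0; first by rewrite T0 !normr0 mulr0.
have nx : 0 < `|x| by rewrite normr_gt0.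
rewrite -ler_pdivrMr//; apply: ub_le_sup.
  exists `|C| => _ [z /= z1 <-]; apply: (le_trans (TC z)).
  apply: (@le_trans _ _ (`|C| * `|z|)); first by rewrite ler_wpM2r// ler_norm.
  by rewrite ler_piMr.
exists (`|x|^-1 *: x) => /=.
  by rewrite normrZ ger0_norm ?invr_ge0// mulVf ?gt_eqF.
have -> : `|x|^-1 *: x = `|x|^-1 *: x + 0 by rewrite addr0.
by rewrite lT T0 addr0 normrZ ger0_norm ?invr_ge0// mulrC.
Qed.

Lemma bounded_linear_cts (C : R) : linear T -> (forall x, `|T x| <= C * `|x|) ->
  continuous T.
Proof.
move=> lT TC x; apply/cvgrPdist_le => e e0.
have c1 : 0 < `|C| + 1 by rewrite ltr_wpDl.
have d0 : 0 < e / (`|C| + 1) by rewrite divr_gt0.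
apply: filterS (nbhsx_ballx x _ d0) => y; rewrite -ball_normE/= => xy.
have -> : T x - T y = T (x - y).
  by rewrite -scaleN1r addrC -lT scaleN1r addrC.
apply: (le_trans (TC _)); apply: (@le_trans _ _ ((`|C| + 1) * `|x - y|)).
  by rewrite ler_wpM2r//; have := ler_norm C; lra.
by rewrite mulrC -ler_pdivlMr// ltW.
Qed.

End OperatorNorm.

Section UniformClosure.
Variables (R : realType) (K : topologicalType).
Implicit Types (A : set (K -> R)) (f g : K -> R).

Lemma closed_uniformP A : closed (A : set {uniform K -> R}) <->
  forall f, (forall e : R, 0 < e -> exists2 g, A g & forall t, `|f t - g t| <= e) ->
    A f.
Proof.
split=> [cA f H|H f Hf].
  apply: cA => B /uniform_nbhs[E [/= entE EB]].
  move: entE; rewrite -entourage_ballE => -[e /= e0 eE].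
  have e2 : 0 < e / 2 by lra.
  have [g Ag fg] := H _ e2; exists g; split=> //; apply: EB => t _.
  apply: eE; rewrite /= -ball_normE/=; apply: (le_lt_trans (fg t)); lra.
apply: H => e e0; have [|g [Ag fg]] := Hf [set g | forall t, `|f t - g t| <= e].
  apply/uniform_nbhs; exists [set xy : R * R | ball xy.1 e xy.2]; split.
    by rewrite -entourage_ballE; exists e.
  by move=> g gf t; have := gf t I; rewrite -ball_normE/= => /ltW.
by exists g.
Qed.

Lemma closed_sublattice_Cfun : closed_sublattice (@Cfun R K).
Proof.
split=> //; first exact: sublattice_Cfun.
apply/closed_uniformP => f H t; apply/cvgrPdist_le => e e0.
have e3 : 0 < e / 3 by lra.
have [g cg fg] := H _ e3; have := cg t; move/cvgrPdist_le => /(_ _ e3).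
apply: filterS => s gs; have := fg t; have := fg s; rewrite [`|f s - _|]distrC.
have := ler_distD (g t) (f t) (f s); have := ler_distD (g s) (g t) (f s).
by move: gs; lra.
Qed.

End UniformClosure.

(** * Representation of the free Banach lattice *)

Section LatticeHomBall.
Variables (R : realType) (X : banachLatticeType R).

Definition hom_ball : set {ptws X -> R} :=
  [set tau | lattice_hom (tau : X -> R^o) /\
             forall x, `|(tau : X -> R) x| <= `|x|].

Let eval_continuous (x : X) : continuous (fun tau : {ptws X -> R} => tau x).
Proof. exact: proj_continuous. Qed.

Let closed_eval_eq (J : Type) (f g : J -> {ptws X -> R} -> R) :
  (forall i, continuous (f i)) -> (forall i, continuous (g i)) ->
  closed [set tau | forall i, f i tau = g i tau].
Proof.
move=> fc gc.
rewrite (_ : mkset _ =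
  \bigcap_(i in setT) ((fun tau => f i tau - g i tau) @^-1` [set 0])).
  apply: closed_bigI => i _; apply: preimage_closed; last exact: closed_eq.
  by move=> tau _; apply: continuousB; [exact: fc|exact: gc].
apply/seteqP; split=> tau /= H i; first by move=> _; rewrite /= H subrr.
by have /eqP := H i I; rewrite subr_eq0 => /eqP.
Qed.

(** Tychonoff's theorem, as for the Banach-Alaoglu theorem. *)
Lemma compact_hom_ball : compact hom_ball.
Proof.
have cb := @tychonoff X (fun=> R) (fun x => `[- `|x|, `|x|]%classic)
  (fun x => @segment_compact R (- `|x|) `|x|).
pose lin : set {ptws X -> R} := [set tau | forall p : R * (X * X),
  tau (p.1 *: p.2.1 + p.2.2) = p.1 * tau p.2.1 + tau p.2.2].
pose sups : set {ptws X -> R} := [set tau | forall p : X * X,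
  tau (vsup p.1 p.2) = Num.max (tau p.1) (tau p.2)].
pose infs : set {ptws X -> R} := [set tau | forall p : X * X,
  tau (vinf p.1 p.2) = Num.min (tau p.1) (tau p.2)].
have -> : hom_ball = (lin `&` (sups `&` infs)) `&`
    [set tau | forall x, `[- `|x|, `|x|]%classic (tau x)].
  apply/seteqP; split=> tau.
    move=> [[tl tS tI] tb]; split.
      split; first by move=> [a [u v]] /=; exact: tl.
      by split=> -[u v] /=; [exact: tS|exact: tI].
    by move=> x /=; rewrite in_itv/= -ler_norml.
  move=> [[tl [tS tI]] tb]; split.
    split=> [a u v _ _|u v _ _|u v _ _].
    - exact: (tl (a, (u, v))).
    - exact: (tS (u, v)).
    - exact: (tI (u, v)).
  by move=> x; have := tb x; rewrite /= in_itv/= -ler_norml.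
rewrite setIC; apply: compact_closedI; first exact: cb.
apply: closedI; last apply: closedI.
- apply: closed_eval_eq => p; first exact: eval_continuous.
  move=> tau; apply: (@continuousD _ _ _ (fun t : {ptws X -> R} => p.1 * t p.2.1)
    (fun t => t p.2.2)); last exact: eval_continuous.
  by apply: continuousM; [exact: cst_continuous|exact: eval_continuous].
- apply: closed_eval_eq => p; first exact: eval_continuous.
  by move=> tau; apply: continuous_max; exact: eval_continuous.
- apply: closed_eval_eq => p; first exact: eval_continuous.
  by move=> tau; apply: continuous_min; exact: eval_continuous.
Qed.

End LatticeHomBall.

Section FreeLattice.
Variables (R : realType) (E : completeNormedModType R) (D : convexity_condition R).
Variables (F : banachLatticeType R) (phi : E -> F).
Hypotheses (hD : AM_convexity D) (hF : free_Dconvex D phi).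
Implicit Types (x : E) (u v : F) (tau sigma : F -> R^o).

Let sT := @sublatticeT R F.
Let DF : Dconvex D F. Proof. by case: hF. Qed.
Let phi_linear : linear phi. Proof. by case: hF. Qed.
Let norm_phi x : `|phi x| = `|x|. Proof. by case: hF. Qed.

Let hom_phi_linear tau : lattice_hom tau -> linear (tau \o phi : E -> R^o).
Proof. by move=> [tl _ _] a x y /=; rewrite phi_linear tl. Qed.

Let hom_phi_continuous tau : lattice_hom tau -> continuous (tau \o phi : E -> R^o).
Proof.
move=> ht; have [C tC] := lattice_hom_bounded ht.
apply: (@bounded_linear_cts _ _ _ _ C) => [|x /=]; first exact: hom_phi_linear.
by rewrite -norm_phi; exact: tC.
Qed.

(** Lattice homomorphisms into the reals are determined by their values on the
    generators, because the real line is a D-convex Banach lattice. *)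
Lemma free_hom_unique sigma tau : lattice_hom sigma -> lattice_hom tau ->
  (forall x, sigma (phi x) = tau (phi x)) -> sigma = tau.
Proof.
move=> hs ht st; case: hF => _ _ _ /(_ R^o (tau \o phi)).
move=> /(_ (@Dconvex_real R D) (hom_phi_linear ht) (hom_phi_continuous ht)).
move=> [h [_ _ huniq _]].
have -> : sigma = h by apply: huniq => //; apply/funext => x; exact: st.
by apply/esym/huniq.
Qed.

(** The universal property bounds the extension by [opnorm]; as [opnorm] is a
    supremum of reals, this carries information only because lattice
    homomorphisms are bounded. *)
Lemma free_hom_extend (b : set_type (dual_ball E)) : exists tau : F -> R^o,
  hom_ball (tau : {ptws F -> R}) /\ forall x, tau (phi x) = delta x b.
Proof.
have [bl bc b1] := set_valP b.
case: hF => _ _ _ /(_ R^o (fun x => delta x b) (@Dconvex_real R D) bl bc).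
move=> [tau [ht tb _ tn]]; exists tau.
split; last by move=> x; exact: (congr1 (@^~ x) tb).
split=> // u; have [C tC] := lattice_hom_bounded ht.
have tl : linear tau by move=> a v w; exact: (hom_lin ht).
apply: (le_trans (le_opnorm u tl tC)); rewrite tn.
by rewrite ler_piMl.
Qed.

Let ext b := projT1 (cid (free_hom_extend b)).
Let ext_hom_ball b : hom_ball (ext b : {ptws F -> R}).
Proof. by rewrite /ext; case: cid => tau []. Qed.
Let ext_hom b : lattice_hom (ext b). Proof. by case: (ext_hom_ball b). Qed.
Let ext_phi b x : ext b (phi x) = delta x b.
Proof. by rewrite /ext; case: cid => tau []. Qed.

Let hom_ball_ext tau : hom_ball (tau : {ptws F -> R}) -> exists b, ext b = tau.
Proof.
move=> [ht tb]; have hb : dual_ball E (tau \o phi : {ptws E -> R}).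
  split; [exact: hom_phi_linear|exact: hom_phi_continuous|].
  apply: opnorm_le1 => [x|]; first by rewrite -norm_phi; exact: tb.
  have p0 : phi 0 = 0 by apply/eqP; rewrite -normr_eq0 norm_phi normr0.
  by rewrite /= p0; exact: hom0 sT ht.
exists (SigSub (mem_set hb)).
by apply: free_hom_unique => [||x]; [exact: ext_hom|exact: ht|exact: ext_phi].
Qed.

(** The representation: [u] acts on a functional of the dual ball through the
    unique lattice homomorphism on [F] that extends it, so that [phi x] acts as
    [delta x]. *)
Definition gelfand u : set_type (dual_ball E) -> R := fun b => ext b u.

Let gelfand_hom : lattice_hom gelfand.
Proof.
split=> [a u v _ _|u v _ _|u v _ _]; apply/funext => b; rewrite /gelfand.
- exact: (hom_lin (ext_hom b)).
- exact: (hom_vsup (ext_hom b)).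
- exact: (hom_vinf (ext_hom b)).
Qed.

Let gelfand_phi x : gelfand (phi x) = delta x.
Proof. by apply/funext => b; exact: ext_phi. Qed.

Let gelfand_le u b : `|gelfand u b| <= `|u|.
Proof. by have [_] := ext_hom_ball b; exact. Qed.

(** A norming homomorphism restricts to a functional in the dual ball. *)
Let gelfand_attains u : exists b, `|gelfand u b| = `|u|.
Proof.
have [tau [ht tb tu]] := norming_hom u (AM_norm_vsup hD DF).
by have [//|b bt] := @hom_ball_ext tau; exists b; rewrite /gelfand bt.
Qed.

Let norm_gelfand u : sup_norm (gelfand u) = `|u|.
Proof.
have [b bu] := gelfand_attains u; apply/le_anti/andP; split.
  by apply: ge_sup; [exists `|gelfand u b|, b|move=> _ [c _ <-]; exact: gelfand_le].
apply: ub_le_sup; last by exists b.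
by exists `|u| => _ [c _ <-]; exact: gelfand_le.
Qed.

(** A homomorphism [sigma] that agrees with [l * tau] on the sublattice agrees
    with it on the generators, hence everywhere, so that the lattice form of
    the Stone-Weierstrass theorem applies on the compact set of homomorphisms. *)
Let gelfand_dense A u e : closed_sublattice A -> range (@delta R E) `<=` A ->
  0 < e -> exists2 v, A (gelfand v) & forall b, `|gelfand u b - gelfand v b| <= e.
Proof.
move=> [AC sA _] dA e0; pose L := [set v | A (gelfand v)].
have sL : sublattice L.
  have [gl gS gI] := gelfand_hom; split.
  - by rewrite /L/= (hom0 sT gelfand_hom); exact: sublattice0 sA.
  - by move=> a v w Lv Lw; rewrite /L/= gl//; exact: sublattice_lin.
  - by move=> v w Lv Lw; rewrite /L/= gS//; exact: sublattice_vsup.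
  - by move=> v w Lv Lw; rewrite /L/= gI//; exact: sublattice_vinf.
have Lphi x : L (phi x) by rewrite /L/= gelfand_phi; apply: dA; exists x.
have evc v : continuous (fun tau : {ptws F -> R} => tau v).
  exact: proj_continuous.
have [t v w [ht _] _ _|t v w [ht _] _ _|v _|s t [hs _] [ht _]|v Lv vu] :=
  @lattice_stone_weierstrass R F {ptws F -> R} (fun v tau => tau v)
    (@hom_ball R F) L u (@compact_hom_ball R F) sL _ _ _ (evc u) _ e e0.
- exact: (hom_vsup ht).
- exact: (hom_vinf ht).
- exact: evc.
- have subL (r : F -> R^o) : lattice_hom r -> lattice_hom_on L r.
    by move=> [rl rS rI]; split=> *; [exact: rl|exact: rS|exact: rI].
  apply: (sublattice_two_points sL (subL s hs) (subL t ht)) => [l l0 st|t0].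
    have -> // : s = (fun v => l * t v).
    apply: free_hom_unique => //; first exact: lattice_hom_scale.
    by move=> x; exact: st (Lphi x).
  have -> // : t = (fun v => 0 * t v).
    apply: free_hom_unique => //; first exact: lattice_hom_scale.
    by move=> x; rewrite mul0r; exact: t0 (Lphi x).
  by rewrite mul0r.
by exists v => // b; exact: vu (ext_hom_ball b).
Qed.

(** With all the continuous functions for [A], this shows that [gelfand u] is
    weak-star continuous. *)
Let gelfand_sub A : closed_sublattice A -> range (@delta R E) `<=` A ->
  range gelfand `<=` A.
Proof.
move=> clA dA _ [u _ <-]; have [_ _ /closed_uniformP] := clA; apply=> e e0.
by have [v Av uv] := gelfand_dense u clA dA e0; exists (gelfand v).
Qed.

Let delta_continuous x : continuous (@delta R E x).
Proof.
move=> b; apply: (continuous_comp (f := set_val) (g := fun f : {ptws E -> R} => f x)).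
  exact: initial_continuous.
exact: proj_continuous.
Qed.

(** The range is closed since [gelfand] is isometric and [F] is complete. *)
Let closed_sublattice_gelfand : closed_sublattice (range gelfand).
Proof.
have [gl gS gI] := gelfand_hom.
split.
- apply: gelfand_sub; first exact: closed_sublattice_Cfun.
  by move=> _ [x _ <-]; exact: delta_continuous.
- split.
  + by exists 0 => //; exact: hom0 sT gelfand_hom.
  + by move=> a _ _ [u _ <-] [v _ <-]; exists (a *: u + v) => //; exact: gl.
  + by move=> _ _ [u _ <-] [v _ <-]; exists (vsup u v) => //; exact: gS.
  + by move=> _ _ [u _ <-] [v _ <-]; exists (vinf u v) => //; exact: gI.
apply/closed_uniformP => f H.
have /choice[u fu] : forall n, exists u,
    forall b, `|f b - gelfand u b| <= n.+1%:R^-1.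
  by move=> n; have [|_ [u _ <-] hu] := H n.+1%:R^-1; [rewrite invr_gt0|exists u].
have gB v w b : gelfand (v - w) b = gelfand v b - gelfand w b.
  by rewrite (homD gelfand_hom)// (homN sT gelfand_hom).
have [v vu] : exists v, forall n, `|v - u n| <= 1 * n.+1%:R^-1.
  apply: natSinv_cauchy_cvg => n k; rewrite mul1r.
  have [b <-] := gelfand_attains (u n - u k); rewrite gB.
  apply: (le_trans (ler_distD (f b) _ _)); apply: lerD; last exact: fu.
  by rewrite distrC; exact: fu.
exists v => //; apply/funext => b; apply/eqP; rewrite -subr_eq0 -normr_eq0.
apply/eqP/le_anti; rewrite normr_ge0 andbT; apply/ler_addgt0Pl => e e0.
have e2 : 0 < e / 2 by lra.
have [n nE] := natSinv_lt e2.
have := ler_distD (gelfand (u n) b) (gelfand v b) (f b).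
have := fu n b; rewrite [`|f b - _|]distrC.
have := le_trans (gelfand_le (v - u n) b) (vu n); rewrite gB.
by move: nE; rewrite mul1r; move: (_^-1 : R) => p; lra.
Qed.

Lemma free_AM_representation :
  exists J : F -> (set_type (dual_ball E) -> R),
    [/\ lattice_hom J,
        forall u : F, sup_norm (J u) = `|u|
      & range J = closed_sublattice_gen (range (@delta R E))].
Proof.
exists gelfand; split=> //; apply/seteqP; split.
  by move=> _ [u _ <-] A [clA dA]; apply: gelfand_sub => //; exists u.
move=> f; apply; split=> // _ [x _ <-].
by exists (phi x).
Qed.

End FreeLattice.

Theorem theorem5p3 (R : realType) (E : completeNormedModType R)
    (D : convexity_condition R) (F : banachLatticeType R) (phi : E -> F)
    (hD : AM_convexity D) (hF : free_Dconvex D phi) :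
  exists J : F -> (set_type (dual_ball E) -> R),
    [/\ lattice_hom J,
        forall u : F, sup_norm (J u) = `|u|
      & range J = closed_sublattice_gen (range (@delta R E))].
Proof. exact: free_AM_representation hD hF. Qed.
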